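(* Suppose that the Basic Assumptions (a)-(c) hold with constants $f_{\mathrm{low}}$, $L_1>0$, $\sigma>0$, $\alpha\in(1,2]$, and that the High-order Smoothness Assumption holds with $p\ge2$ and $L_p>0$. Define $$M_{p,\alpha} := 4\Big(f(x^0) - f_{\mathrm{low}} + 4^{1/3}\sigma^\alpha + \frac{L_1}{2} + 30^{1/(\alpha-1)}(\alpha-1)(2/\alpha)^{\alpha/(\alpha-1)} + \frac{306\, p^{2\alpha p} L_p^\alpha}{(p!)^\alpha} +64(p-1)^\alpha\sigma^\alpha\Big).$$ Let $\{x^k\}$ be generated by the normalized SFOM with multi-extrapolated momentum with input parameters $q=p-1$, $$\eta_k=\frac{1}{(k+4)^{(p\alpha+\alpha-1)/(p(2\alpha-1)+\alpha-1)}}\qquad\forall k\ge0,$$ $$\gamma_{k,t}=\frac{\gamma_k}{t^2},\qquad \theta_{k,t}=\frac{\prod_{1\le s\le p-1,\,s\neq t}(1-s^2/\gamma_k)}{(t^2/\gamma_k)\prod_{1\le s\le p-1,\,s\neq t}((t^2-s^2)/\gamma_k)}\qquad\forall 1\le t\le p-1,\ k\ge0,$$ where $$\gamma_k=\frac{1}{(k+4)^{p\alpha/(p(2\alpha-1)+\alpha-1)}}\qquad\forall k\ge0.$$ Then, for any $\epsilon \in (0,1)$, it holds that $\mathbb{E}[\|\nabla f(x^{\iota_K})\|]\le \epsilon$ for all integers $K$ satisfying $$K\ge \max\Big\{\Big(\frac{2(p(2\alpha-1) + \alpha -1)M_{p,\alpha}}{p(\alpha-1)\epsilon}\ln\Big(\frac{2(p(2\alpha-1)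 + \alpha -1)M_{p,\alpha}}{p(\alpha-1)\epsilon}\Big)\Big)^{(p(2\alpha-1)+\alpha-1)/(p(\alpha-1))},5\Big\},$$ where $\iota_K$ is uniformly drawn from $\{0,\ldots,K-1\}$.
   Context: Setting. $\|\cdot\|$ is the Euclidean norm on $\mathbb{R}^n$. The function $f:\mathbb{R}^n\to\mathbb{R}$ is continuously differentiable and the problem $\min_{x\in\mathbb{R}^n} f(x)$ has at least one optimal solution. $\xi$ is a random variable with sample space $\Xi$, and $G:\mathbb{R}^n\times\Xi\to\mathbb{R}^n$ is a stochastic gradient estimator. Empty products equal $1$. Basic Assumptions. (a) There is a finite $f_{\mathrm{low}}$ with $f(x)\ge f_{\mathrm{low}}$ for all $x\in\mathbb{R}^n$. (b) There is $L_1>0$ with $\|\nabla f(x)-\nabla f(y)\|\le L_1\|x-y\|$ for all $x,y\in\mathbb{R}^n$. (c) $\mathbb{E}[G(x;\xi)]=\nabla f(x)$ and $\mathbb{E}[\|G(x;\xi)-\nabla f(x)\|^\alpha]\le\sigma^\alpha$ for all $x\in\mathbb{R}^n$, for some $\sigma>0$ and $\alpha\in(1,2]$. High-order Smoothness Assumption. $f$ is $p$th-order continuously differentiable on $\mathbb{R}^n$ for some integer $p\ge2$, and there is $L_p>0$ with $\|\mathcal{D}^p f(x)-\mathcal{D}^p f(y)\|\le L_p\|x-y\|$ for all $x,y\in\mathbb{R}^n$. Here $\mathcal{D}^p f(x)[h_1,\ldots,h_p]$ is the $p$th-order directional derivative of $f$ at $x$ along $h_1,\dots,h_p$, $\mathcal{D}^pf(x)[\cdot]$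 is the associated symmetric $p$-linear form, and a symmetric $p$-linear form $\mathcal{T}$ has norm $\|\mathcal{T}\|=\max\{\mathcal{T}[h_1,\ldots,h_p]:\|h_i\|\le1,\ 1\le i\le p\}$. Normalized SFOM with multi-extrapolated momentum. Input: a starting point $x^0\in\mathbb{R}^n$, step sizes $\{\eta_k\}_{k\ge0}\subset(0,+\infty)$, an integer $q\ge1$, extrapolation parameters $\{\gamma_{k,t}\}\subset(0,1)$, weights $\{\theta_{k,t}\}$ ($1\le t\le q$, $k\ge0$) with $\sum_{t=1}^q\theta_{k,t}\in(0,1)$ for all $k\ge0$. Initialize $x^{-1}=x^0$, $m^{-1}=0$, $(\gamma_{-1,t},\theta_{-1,t})=(1,1/q)$ for $1\le t\le q$. For $k=0,1,2,\ldots$: $z^{k,t}=x^k+\frac{1-\gamma_{k-1,t}}{\gamma_{k-1,t}}(x^k-x^{k-1})$ for $1\le t\le q$; $m^k=\big(1-\sum_{t=1}^q\theta_{k-1,t}\big)m^{k-1}+\sum_{t=1}^q\theta_{k-1,t}G(z^{k,t};\xi^k)$; $x^{k+1}=x^k-\eta_k m^k/\|m^k\|$, where $\{\xi^k\}$ is a sequence of independently drawn samples of $\xi$. The iteration is understood to be well defined, i.e. $m^k\ne0$ for all $k$. The index $\iota_K$ is drawn independently of the algorithm's samples, so $\mathbb{E}[\|\nabla f(x^{\iota_K})\|]=\frac1K\sum_{k=0}^{K-1}\mathbb{E}[\|\nabla f(x^k)\|]$. *)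

(* Defs.v *)
From HB Require Import structures.
From mathcomp Require Import all_boot all_order all_algebra finmap.
From mathcomp Require Import all_classical all_reals all_analysis.

Set Implicit Arguments.
Unset Strict Implicit.
Unset Printing Implicit Defensive.

Import Order.TTheory GRing.Theory Num.Theory.
Import numFieldNormedType.Exports.

Local Open Scope classical_set_scope.
Local Open Scope ring_scope.

(* The library's norm `|v| on 'rV[R]_n is the sup norm, hence this one. *)
Definition enorm {R : realType} {n : nat} (v : 'rV[R]_n) : R :=
  Num.sqrt (\sum_i v ord0 i ^+ 2).

Definition grad {R : realType} {n : nat} (f : 'rV[R]_n -> R) (x : 'rV[R]_n) :
    'rV[R]_n :=
  \row_i 'D_(delta_mx ord0 i) f x.

(* [Ck k f]: f is k times continuously differentiable. In finite dimension
   x |-> D f(x) is of class C^k iff x |-> D f(x)[v] is, for every v. *)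
Fixpoint Ck {R : realType} {n : nat} (k : nat) (f : 'rV[R]_n -> R) : Prop :=
  if k is j.+1 then
    (forall x, differentiable f x) /\
    (forall v, Ck j (fun x => 'D_v f x))
  else continuous f.

(* [Dform f hs x] = D^p f(x)[h_1, ..., h_p] for hs = [:: h_1; ...; h_p]. *)
Fixpoint Dform {R : realType} {n : nat} (f : 'rV[R]_n -> R)
    (hs : seq 'rV[R]_n) : 'rV[R]_n -> R :=
  if hs is h :: hs' then fun x => 'D_h (Dform f hs') x else f.

(* Norm of a p-linear form. The maximum of the definition is written as a
   supremum in \bar R, so that no junk value can occur. *)
Definition form_norm {R : realType} {n p : nat}
    (T : p.-tuple 'rV[R]_n -> R) : \bar R :=
  ereal_sup [set (T h)%:E | h in
    [set h : p.-tuple 'rV[R]_n | forall i, enorm (tnth h i) <= 1]].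

(* Joint measurability of G : R^n x Xi -> R^n, with R^n carrying the product
   (= Borel) sigma-algebra, which the library provides on n.-tuple R. *)
Definition jointly_measurable {R : realType} {n : nat} {d : measure_display}
    {Xi : measurableType d} (G : 'rV[R]_n -> Xi -> 'rV[R]_n) : Prop :=
  forall i : 'I_n, measurable_fun setT
    (fun u : (n.-tuple R * Xi)%type => G (\row_j tnth u.1 j) u.2 ord0 i : R).

Section Probability.
Context {R : realType} {d d' : measure_display} {Om : measurableType d}
  {Xi : measurableType d'} {P : probability Om R}.
Implicit Types X : nat -> {RV P >-> Xi}.

Definition same_distribution (Y Z : {RV P >-> Xi}) : Prop :=
  forall A, measurable A -> distribution P Y A = distribution P Z A.

Definition mutually_independent X : Prop :=
  forall (J : {fset nat}) (A : nat -> set Xi),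
    (forall j, measurable (A j)) ->
    P (\bigcap_(j in [set` J]) (X j @^-1` A j)) =
      (\prod_(j <- J) P (X j @^-1` A j))%E.

Definition generated_events X : set (set Om) :=
  <<s [set E | exists j A, measurable A /\ E = X j @^-1` A] >>.

Definition independent_of_samples (iota : {RV P >-> nat}) X : Prop :=
  forall (B : set nat) (E : set Om), generated_events X E ->
    P ((iota @^-1` B) `&` E) = (P (iota @^-1` B) * P E)%E.

Definition uniform_index (K : nat) (iota : {RV P >-> nat}) : Prop :=
  forall i, (i < K)%N -> P (iota @^-1` [set i]) = (K%:R^-1)%:E.

End Probability.

(* The sequence k |-> a_(k-1), given a_(-1) = am1. *)
Definition lag {T : Type} (am1 : T) (a : nat -> T) (k : nat) : T :=
  if k is j.+1 then a j else am1.

Section Algorithm.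
Context {R : realType} {n : nat} {Xi : Type}.
Local Notation V := 'rV[R]_n.

Definition extrapolation (gamma : nat -> nat -> R) (x0 : V) (x : nat -> V)
    (k t : nat) : V :=
  let g := lag 1 (gamma^~ t) k in
  x k + ((1 - g) / g) *: (x k - lag x0 x k).

(* One sample path (x^k), (m^k) of the normalized method with multi-extrapolated
   momentum, for the realized samples s = (xi^k). The range conditions on the
   inputs (eta_k > 0, 0 < gamma_{k,t} < 1, 0 < sum_t theta_{k,t} < 1) play no
   role in the recursion. *)
Record multi_extrapolated_path (G : V -> Xi -> V) (x0 : V) (q : nat)
    (eta : nat -> R) (gamma theta : nat -> nat -> R) (s : nat -> Xi)
    (x m : nat -> V) : Prop := MultiExtrapolatedPath {
  path_init : x 0%N = x0;
  path_momentum : forall k, m k =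
    (1 - \sum_(1 <= t < q.+1) lag (q%:R^-1) (theta^~ t) k) *: lag 0 m k
    + \sum_(1 <= t < q.+1) lag (q%:R^-1) (theta^~ t) k *:
        G (extrapolation gamma x0 x k t) (s k);
  path_step : forall k, x k.+1 = x k - (eta k / enorm (m k)) *: m k
}.

End Algorithm.

Section Choices.
Context {R : realType}.
Context (p : nat) (alpha : R).

Definition rate_denom : R := p%:R * (2 * alpha - 1) + alpha - 1.

Definition eta_seq (k : nat) : R :=
  1 / (k + 4)%:R `^ ((p%:R * alpha + alpha - 1) / rate_denom).

Definition gamma_seq (k : nat) : R :=
  1 / (k + 4)%:R `^ (p%:R * alpha / rate_denom).

Definition gamma_par (k t : nat) : R := gamma_seq k / t%:R ^+ 2.

Definition theta_par (k t : nat) : R :=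
  (\prod_(1 <= s < p | s != t) (1 - s%:R ^+ 2 / gamma_seq k)) /
  (t%:R ^+ 2 / gamma_seq k *
   \prod_(1 <= s < p | s != t) ((t%:R ^+ 2 - s%:R ^+ 2) / gamma_seq k)).

(* [gap] stands for f(x^0) - f_low. *)
Definition M_const (gap L1 sigma Lp : R) : R :=
  4 * (gap + 4 `^ (1 / 3) * sigma `^ alpha + L1 / 2
       + 30 `^ (1 / (alpha - 1)) * (alpha - 1)
           * (2 / alpha) `^ (alpha / (alpha - 1))
       + 306 * p%:R `^ (2 * alpha * p%:R) * Lp `^ alpha / (p`!)%:R `^ alpha
       + 64 * (p%:R - 1) `^ alpha * sigma `^ alpha).

End Choices.

(* Main.v *)
Require Import Defs.
From HB Require Import structures.
From mathcomp Require Import all_boot all_order all_algebra finmap ring lra zify.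
From mathcomp Require Import all_classical all_reals all_analysis measurable_realfun.

Set Implicit Arguments.
Unset Strict Implicit.
Unset Printing Implicit Defensive.

Import Order.TTheory GRing.Theory Num.Theory.
Import numFieldNormedType.Exports.

Local Open Scope classical_set_scope.
Local Open Scope ring_scope.

(** Let [delta k = m k - grad f (x k)] be the momentum error. A normalized step of
    length [eta k] decreases [f] up to this error ([one_step_descent]):
    [eta k * |grad f (x k)| <= f (x k) - f (x k.+1) + 2 * eta k * |delta k|
    + L1 * eta k ^ 2 / 2]. Summed over [k], the values of [f] telescope and the
    theorem reduces to controlling the [alpha]-th moment of [delta k].

    That moment satisfies a contracting recursion ([error_moment_succ]). The points
    of evaluation lie at [node t = t ^ 2 / gamma k] times the step
    [x k.+1 - x k] from [x k], and the weights [theta k t] are the Lagrange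
    coefficients at [1] for the nodes [0, node 1, ..., node p.-1]
    ([weight_exact]). The combination of gradients that enters the momentum
    therefore reproduces [grad f (x k.+1)] up to Taylor remainders of order [p]
    ([extrapolation_bias]). The sum of the weights lies between [gamma k] and [1],
    so convexity of the power gives a contraction by [1 - gamma k]
    ([drift_powR_le]). The noise is centered given the past, so the first-order
    term of [|u + v| ^ alpha] vanishes after integration and only the [alpha]-th
    moment of the noise is added ([enormD_powR], [noisy_moment_le]). This is made
    rigorous by Tonelli's theorem: the fresh sample is independent of the
    sigma-algebra of the previous ones, so it may be integrated with the past
    frozen ([independent_past], [integral_independent]).

    The error moment is then weighted by a power [pot k] of [k + 4] whose exponent
    is such that the bias, the noise and the remainder of Young's inequality
    applied to [2 * eta k * |delta k|] all become constant multiples of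
    [1 / (k + 4)] ([pot_bias], [pot_noise], [young_momentum]), while the growth
    of the weight is absorbed by the contraction ([pot_contraction]). Their sum
    over [k < K] is at most a constant times [ln K] ([potential_sum_le],
    [harmonic_le_ln]), and division by [K * eta K.-1] gives the mean gradient
    norm, which is the expectation at the uniform index
    ([integral_uniform_index]), a bound of order [K ^ (- rho) * ln K] with
    [rho = p * (alpha - 1) / rate_denom p alpha]. The condition on [K] inverts
    this rate ([mul_ln_le], [final_rate_le]). *)

(** * Euclidean norm and power inequalities *)

Section EuclideanNorm.
Context {R : realType} {n : nat}.
Implicit Types (u v w : 'rV[R]_n) (c : R).

Definition dot u v : R := \sum_i u ord0 i * v ord0 i.

Lemma enorm_ge0 v : 0 <= enorm v.
Proof. exact: sqrtr_ge0. Qed.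

Lemma enorm_sqr v : enorm v ^+ 2 = \sum_i v ord0 i ^+ 2.
Proof. by rewrite sqr_sqrtr// sumr_ge0// => i _; exact: sqr_ge0. Qed.

Lemma dotvv v : dot v v = enorm v ^+ 2.
Proof. by rewrite enorm_sqr; apply: eq_bigr => i _; rewrite expr2. Qed.

Lemma dotC u v : dot u v = dot v u.
Proof. by apply: eq_bigr => i _; rewrite mulrC. Qed.

Lemma dotDl u v w : dot (u + v) w = dot u w + dot v w.
Proof. by rewrite -big_split/=; apply: eq_bigr => i _; rewrite mxE mulrDl. Qed.

Lemma dotZl c u v : dot (c *: u) v = c * dot u v.
Proof. by rewrite mulr_sumr; apply: eq_bigr => i _; rewrite mxE mulrA. Qed.

Lemma dotDr u v w : dot w (u + v) = dot w u + dot w v.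
Proof. by rewrite dotC dotDl !(dotC w). Qed.

Lemma dotZr c u v : dot u (c *: v) = c * dot u v.
Proof. by rewrite dotC dotZl dotC. Qed.

Lemma dotNl u v : dot (- u) v = - dot u v.
Proof. by rewrite -scaleN1r dotZl mulN1r. Qed.

Lemma dotNr u v : dot u (- v) = - dot u v.
Proof. by rewrite dotC dotNl dotC. Qed.

Lemma dot0l v : dot 0 v = 0.
Proof. by rewrite -(scale0r v) dotZl mul0r. Qed.

Lemma dot_suml (I : Type) (r : seq I) (Q : pred I) (F : I -> 'rV[R]_n) v :
  dot (\sum_(i <- r | Q i) F i) v = \sum_(i <- r | Q i) dot (F i) v.
Proof.
by elim/big_rec2: _ => [|i a b _ <-]; [exact: dot0l | rewrite dotDl].
Qed.

Lemma enormD_sqr u v :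
  enorm (u + v) ^+ 2 = enorm u ^+ 2 + 2 * dot u v + enorm v ^+ 2.
Proof. by rewrite -!dotvv dotDl !dotDr (dotC v u); ring. Qed.

Lemma enormZ c v : enorm (c *: v) = `|c| * enorm v.
Proof.
apply/eqP; rewrite -(@eqrXn2 _ 2)// ?mulr_ge0 ?enorm_ge0//.
by rewrite exprMn real_normK ?num_real// -!dotvv dotZl dotZr mulrA -expr2.
Qed.

Lemma enormN v : enorm (- v) = enorm v.
Proof. by rewrite -scaleN1r enormZ normrN1 mul1r. Qed.

Lemma enorm0 : enorm (0 : 'rV[R]_n) = 0.
Proof. by rewrite -(scale0r 0) enormZ normr0 mul0r. Qed.

Lemma enorm_eq0 v : enorm v = 0 -> v = 0.
Proof.
move=> v0; have /psumr_eq0P h : \sum_i v ord0 i ^+ 2 = 0.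
  by rewrite -enorm_sqr v0 expr0n.
apply/rowP => i; rewrite mxE; apply/eqP; rewrite -sqrf_eq0; apply/eqP.
by apply: h => // j _; exact: sqr_ge0.
Qed.

Lemma enorm_gt0 v : v != 0 -> 0 < enorm v.
Proof.
move=> v0; rewrite lt_neqAle enorm_ge0 andbT eq_sym.
by apply: contra_neq v0; exact: enorm_eq0.
Qed.

Lemma enorm_normalize v : v != 0 -> enorm ((enorm v)^-1 *: v) = 1.
Proof.
move=> /enorm_gt0 v0.
by rewrite enormZ ger0_norm ?invr_ge0 ?(ltW v0)// mulVf ?gt_eqF.
Qed.

Lemma cauchy_schwarz u v : dot u v <= enorm u * enorm v.
Proof.
have [->|/enorm_gt0 u0] := eqVneq u 0; first by rewrite dot0l enorm0 mul0r.
have [->|/enorm_gt0 v0] := eqVneq v 0; first by rewrite dotC dot0l enorm0 mulr0.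
have := sqr_ge0 (enorm (enorm v *: u + (- enorm u) *: v)).
rewrite enormD_sqr !enormZ !exprMn !real_normK ?num_real// sqrrN dotZl dotZr.
set a := enorm u in u0 *; set b := enorm v in v0 *; move=> h.
have : 0 <= (2 * (a * b)) * (a * b - dot u v) by lra.
by rewrite pmulr_rge0 ?subr_ge0// ?mulr_gt0.
Qed.

Lemma cauchy_schwarz_ge u v : - (enorm u * enorm v) <= dot u v.
Proof. by rewrite lerNl -dotNl -(enormN u) cauchy_schwarz. Qed.

Lemma enormD u v : enorm (u + v) <= enorm u + enorm v.
Proof.
rewrite -(@ler_pXn2r _ 2) ?nnegrE ?addr_ge0 ?enorm_ge0// enormD_sqr.
have := cauchy_schwarz u v; lra.
Qed.

Lemma enorm_sum (I : Type) (r : seq I) (Q : pred I) (F : I -> 'rV[R]_n) :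
  enorm (\sum_(i <- r | Q i) F i) <= \sum_(i <- r | Q i) enorm (F i).
Proof.
elim/big_rec2: _ => [|i a b _ h]; first by rewrite enorm0.
by rewrite (le_trans (enormD _ _))// lerD2l.
Qed.

Lemma coord_le_enorm v i : `|v ord0 i| <= enorm v.
Proof.
rewrite -(@ler_pXn2r _ 2) ?nnegrE ?enorm_ge0// enorm_sqr real_normK ?num_real//.
by rewrite (bigD1 i)//= lerDl sumr_ge0// => j _; exact: sqr_ge0.
Qed.

(** The Euclidean norm is attained against unit vectors; the remainder bounds
    below are proved one direction at a time and reassembled through this. *)
Lemma enorm_le_dual v c : 0 <= c ->
  (forall u, enorm u = 1 -> dot v u <= c) -> enorm v <= c.
Proof.
move=> c0 h; have [->|v0] := eqVneq v 0; first by rewrite enorm0.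
have := h _ (enorm_normalize v0).
by rewrite dotZr dotvv expr2 mulrA mulVf ?mul1r// gt_eqF// enorm_gt0.
Qed.

End EuclideanNorm.

Section PowerInequalities.
Context {R : realType}.
Implicit Types (a r x y : R).

(** Young's inequality read as the tangent line of [x `^ a] at [y]; the
    convexity estimates of the proof are all instances of it. *)
Lemma powR_tangent a x y : 1 <= a -> 0 <= x -> 0 <= y ->
  a * (y `^ (a - 1) * x) <= x `^ a + (a - 1) * y `^ a.
Proof.
rewrite le_eqVlt => /predU1P[<- x0 y0|a1 x0 y0].
  by rewrite subrr powRr0 powRr1// mul0r addr0 !mul1r.
have a0 : 0 < a by lra.
have b0 : 0 < a - 1 by lra.
have h := @conjugate_powR R x (y `^ (a - 1)) a (a / (a - 1)) x0
  (powR_ge0 _ _) a0 (divr_gt0 a0 b0).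
have {}h := h ltac:(by field; rewrite !gt_eqF).
rewrite -powRrM (_ : (a - 1) * (a / (a - 1)) = a) in h; last first.
  by field; rewrite gt_eqF.
rewrite -(ler_pM2l a0) in h; rewrite [X in a * X]mulrC (le_trans h)//.
by rewrite le_eqVlt; apply/orP; left; apply/eqP; field; rewrite !gt_eqF.
Qed.

Lemma bernoulli_powR r x : 0 < r <= 1 -> -1 <= x ->
  (1 + x) `^ r <= 1 + r * x.
Proof.
move=> /andP[r0 r1] x1.
have x0 : 0 <= 1 + x by lra.
have := @powR_tangent r^-1 ((1 + x) `^ r) 1 _ (powR_ge0 _ _) ler01.
rewrite -powRrM mulfV ?gt_eqF// powRr1// !powR1 mul1r mulr1 invf_ge1//.
move=> /(_ r1); rewrite -(ler_pM2l r0) mulrA mulfV ?gt_eqF// mul1r.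
by rewrite mulrDr mulrBr mulfV ?gt_eqF//; lra.
Qed.

Lemma powR_convex a l x y : 1 <= a -> 0 <= l <= 1 -> 0 <= x -> 0 <= y ->
  ((1 - l) * x + l * y) `^ a <= (1 - l) * x `^ a + l * y `^ a.
Proof.
move=> a1 /andP[l0 l1] x0 y0; set z := _ + _.
have z0 : 0 <= z by rewrite addr_ge0// mulr_ge0//; lra.
have hx := powR_tangent a1 x0 z0; have hy := powR_tangent a1 y0 z0.
have := mulr_powRB1 z0 (lt_le_trans ltr01 a1).
set t := z `^ (a - 1) in hx hy *; rewrite mulrC => zE.
have l1' : 0 <= 1 - l by lra.
have {}hx := ler_wpM2l l1' hx; have {}hy := ler_wpM2l l0 hy.
have := lerD hx hy; rewrite -zE /z; lra.
Qed.

(** Jensen's inequality: the sum of the tangent inequalities at the mean of the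
    [F i]. *)
Lemma powR_sum (I : eqType) (s : seq I) (F : I -> R) a : 1 <= a ->
  (0 < size s)%N -> (forall i, 0 <= F i) ->
  (\sum_(i <- s) F i) `^ a <=
    (size s)%:R `^ (a - 1) * \sum_(i <- s) F i `^ a.
Proof.
move=> a1 s0 F0; set S := \sum_(i <- s) F i; set N := (size s)%:R : R.
have S0 : 0 <= S by apply: sumr_ge0.
have N0 : 0 < N by rewrite ltr0n.
have z0 : 0 <= S / N by rewrite divr_ge0// ltW.
have h : \sum_(i <- s) (a * ((S / N) `^ (a - 1) * F i)) <=
         \sum_(i <- s) (F i `^ a + (a - 1) * (S / N) `^ a).
  by apply: ler_sum => i _; exact: powR_tangent.
rewrite big_split/= -mulr_sumr -mulr_sumr -/S in h.
rewrite big_const_seq count_predT iter_addr_0 -mulr_natr -/N in h.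
have e := mulr_powRB1 z0 (lt_le_trans ltr01 a1).
have NS : N * (S / N) = S by rewrite mulrC mulfVK// gt_eqF.
have h2 : N * (S / N) `^ a <= \sum_(i <- s) F i `^ a.
  have e2 : (S / N) `^ (a - 1) * S = N * (S / N) `^ a by rewrite -e -{2}NS;
    ring.
  by rewrite e2 in h; lra.
have -> : S `^ a = N `^ (a - 1) * (N * (S / N) `^ a).
  rewrite mulrA [_ * N]mulrC mulr_powRB1 ?(ltW N0)//; last lra.
  by rewrite -powRM ?(ltW N0)// NS.
by rewrite ler_pM2l// powR_gt0.
Qed.

(** When [v] is shorter than [u], the relative increment of the squared norm is
    at least [-1], Bernoulli's inequality linearizes its power [a / 2], and the
    quadratic term left over is at most [enorm v `^ a] because [a <= 2].
    Otherwise every term is dominated by [enorm v `^ a], the cross term through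
    the Cauchy-Schwarz inequality. *)
Lemma enormD_powR n (u v : 'rV[R]_n) a : 1 <= a <= 2 ->
  enorm (u + v) `^ a <=
    enorm u `^ a + a * (enorm u `^ (a - 2) * dot u v) + 6 * enorm v `^ a.
Proof.
move=> /andP[a1 a2]; have [uv|vu] := leP (enorm u) (enorm v).
- have v0 := enorm_ge0 v; have u0 := enorm_ge0 u.
  have h1 : enorm (u + v) `^ a <= 4 * enorm v `^ a.
    apply: (@le_trans _ _ ((2 * enorm v) `^ a)).
      rewrite ge0_ler_powR ?nnegrE ?enorm_ge0//; [lra|lra|].
      by have := enormD u v; lra.
    rewrite powRM//; apply: ler_wpM2r; first exact: powR_ge0.
    rewrite (_ : 4 = 2 `^ 2%:R); last by rewrite powR_mulrn//; ring.
    by apply: ler_powR => //; lra.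
  have h2 : - (enorm v `^ a) <= enorm u `^ (a - 2) * dot u v.
    have [u0'|/enorm_gt0 u0'] := eqVneq u 0.
      by rewrite u0' dot0l mulr0 oppr_le0 powR_ge0.
    apply: (@le_trans _ _ (enorm u `^ (a - 2) * - (enorm u * enorm v))).
      rewrite mulrN lerN2.
      have -> : enorm u `^ (a - 2) * (enorm u * enorm v) =
                enorm u `^ (a - 1) * enorm v.
        rewrite mulrA; congr (_ * _).
        rewrite -{2}[enorm u]powRr1// -powRD ?(gt_eqF u0') ?implybT//.
        by congr (_ `^ _); lra.
      rewrite -[X in _ <= X](mulr_powRB1 v0); last lra.
      rewrite mulrC ler_wpM2l// ge0_ler_powR ?nnegrE//; lra.
    by rewrite ler_wpM2l ?powR_ge0// cauchy_schwarz_ge.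
  have := powR_ge0 (enorm u) a; have := powR_ge0 (enorm v) a.
  set t := enorm u `^ (a - 2) * _ in h2 *; nra.
- have v0 := enorm_ge0 v; have u0 : 0 < enorm u by lra.
  (* relative increment of the squared norm *)
  pose x := (2 * dot u v + enorm v ^+ 2) / enorm u ^+ 2.
  have e1 : enorm (u + v) ^+ 2 = enorm u ^+ 2 * (1 + x).
    by rewrite enormD_sqr /x; field; rewrite gt_eqF.
  have x1 : -1 <= x.
    have : 0 <= enorm u ^+ 2 * (1 + x) by rewrite -e1 sqr_ge0.
    by rewrite pmulr_rge0 ?exprn_gt0//; lra.
  have sqp (w : 'rV[R]_n) : enorm w `^ a = (enorm w ^+ 2) `^ (a / 2).
    rewrite -powR_mulrn ?enorm_ge0// -powRrM; congr (_ `^ _).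
    by field.
  rewrite (sqp (u + v)) e1 powRM ?sqr_ge0//; last lra.
  rewrite -sqp.
  have h1 := @bernoulli_powR (a / 2) x ltac:(lra) x1.
  apply: (le_trans (ler_wpM2l (powR_ge0 _ _) h1)).
  have e2 : enorm u `^ a = enorm u `^ (a - 2) * enorm u ^+ 2.
    rewrite -powR_mulrn ?(ltW u0)// -powRD ?(gt_eqF u0) ?implybT//.
    by congr (_ `^ _); ring.
  have -> : enorm u `^ a * (1 + a / 2 * x) = enorm u `^ a +
      a * (enorm u `^ (a - 2) * dot u v) +
      a / 2 * (enorm u `^ (a - 2) * enorm v ^+ 2).
    by rewrite e2 /x; field; rewrite gt_eqF.
  rewrite lerD2l.
  have [v00|vp] := eqVneq (enorm v) 0.
    by rewrite v00 expr0n/= mulr0 mulr0 mulr_ge0// powR_ge0.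
  have {}vp : 0 < enorm v by rewrite lt_neqAle eq_sym vp.
  have h3 : enorm u `^ (a - 2) * enorm v ^+ 2 <= enorm v `^ a.
    have -> : enorm v `^ a = enorm v `^ (a - 2) * enorm v ^+ 2.
      rewrite -powR_mulrn// -powRD ?(gt_eqF vp) ?implybT//.
      by congr (_ `^ _); ring.
    rewrite ler_wpM2r ?sqr_ge0// -(opprB 2) !powRN lef_pV2 ?posrE ?powR_gt0//.
    by rewrite ge0_ler_powR ?nnegrE ?(ltW u0) ?(ltW vu)//; lra.
  have := powR_ge0 (enorm v) a.
  set t := enorm u `^ (a - 2) * _ in h3 *; nra.
Qed.

End PowerInequalities.

(** * Lagrange weights *)

Section LagrangeWeights.
Context {R : realType}.
Variables (g : R) (p : nat).
Hypothesis g01 : 0 < g < 1.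

(** The extrapolated point of index [t] lies at [node t] times the last step
    from the previous iterate. *)
Definition node (s : nat) : R := s%:R ^+ 2 / g.

Definition weight (t : nat) : R :=
  (\prod_(1 <= s < p | s != t) (1 - s%:R ^+ 2 / g)) /
  (t%:R ^+ 2 / g * \prod_(1 <= s < p | s != t) ((t%:R ^+ 2 - s%:R ^+ 2) / g)).

Let g0 : 0 < g. Proof. by case/andP: g01. Qed.
Let g_neq0 : g != 0. Proof. by rewrite gt_eqF. Qed.

Lemma node_inj : injective node.
Proof.
move=> s t /(divIf g_neq0) /eqP; rewrite eqrXn2 ?ler0n// eqr_nat.
by move=> /eqP.
Qed.

Let basis_at1 (i : nat) : R :=
  (\prod_(0 <= j < p | j != i) (node i - node j))^-1 *
  \prod_(0 <= j < p | j != i) (1 - node j).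

Lemma basis_at1_weight t : (0 < t)%N -> (t < p)%N -> basis_at1 t = weight t.
Proof.
move=> t0 tp; rewrite /basis_at1 /weight.
have p0 : (0 < p)%N by exact: leq_ltn_trans tp.
rewrite !(@big_ltn_cond _ _ _ 0%N p)// eq_sym -lt0n t0.
have -> : node 0 = 0 by rewrite /node expr0n mul0r.
rewrite !subr0 mul1r mulrC; congr (_ / (_ * _)).
by apply: eq_bigr => s _; rewrite /node mulrBl.
Qed.

Hypothesis p0 : (0 < p)%N.

Lemma lagrange_eval1 (Q : {poly R}) : (size Q <= p)%N ->
  Q.[1] = basis_at1 0 * Q.[0] + \sum_(1 <= t < p) weight t * Q.[node t].
Proof.
move=> sQ.
have -> : Q.[1] = \sum_(0 <= t < p) basis_at1 t * Q.[node t].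
  rewrite big_mkord [in LHS](lagrange_gen p0 node_inj sQ) horner_sum.
  apply: eq_bigr => i _.
  rewrite hornerM hornerC lagrangeE//; last exact: node_inj.
  rewrite hornerM hornerC !horner_prod /basis_at1 !big_mkord mulrC.
  congr (_^-1 * _ * _); apply: eq_bigr => j _; by rewrite hornerXsubC.
rewrite big_ltn//; congr (_ * _.[_] + _).
  by rewrite /node expr0n mul0r.
by apply: eq_big_nat => t /andP[t1 tp]; rewrite basis_at1_weight.
Qed.

Lemma sum_weightE :
  1 - \sum_(1 <= t < p) weight t = \prod_(1 <= s < p) (1 - g / s%:R ^+ 2).
Proof.
have h := @lagrange_eval1 1 _; rewrite size_poly1 in h.
have -> : 1 - \sum_(1 <= t < p) weight t = basis_at1 0.
  have {h} := h p0; rewrite !hornerC mulr1 => {1}->.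
  by under [X in _ - X]eq_bigr do rewrite -[weight _]mulr1;
     under [X in _ + X - _]eq_bigr do rewrite hornerC; rewrite addrK.
rewrite /basis_at1 !(@big_ltn_cond _ _ _ 0%N p)//= mulrC -prodf_div.
rewrite big_nat_cond [RHS]big_nat_cond.
apply: eq_big => [[|s]|s]; rewrite ?andbT//.
move=> /andP[/andP[s1 sp] _].
have s0 : s%:R != 0 :> R by rewrite pnatr_eq0 -lt0n.
by rewrite /node expr0n mul0r; field; rewrite s0 g_neq0.
Qed.

(** The weights are the Lagrange coefficients at [1] for the nodes
    [0 = node 0, node 1, ..., node p.-1], so that the affine combination they
    define extrapolates exactly every polynomial of degree less than [p]. *)
Lemma weight_exact (Q : {poly R}) : (size Q <= p)%N ->
  Q.[1] = (1 - \sum_(1 <= t < p) weight t) * Q.[0]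
          + \sum_(1 <= t < p) weight t * Q.[node t].
Proof.
move=> sQ; rewrite lagrange_eval1//; congr (_ * _ + _).
have h := @lagrange_eval1 1 _; rewrite size_poly1 in h.
have {h} := h p0; rewrite !hornerC mulr1 => {1}->.
by under [X in _ = _ - X]eq_bigr do rewrite -[weight _]mulr1;
   under [X in _ = _ + X - _]eq_bigr do rewrite hornerC; rewrite addrK.
Qed.

End LagrangeWeights.

Section WeightBounds.
Context {R : realType}.
Variables (g : R) (p : nat).
Hypothesis g01 : 0 < g < 1.

(** [1 - sum] is the product of the [1 - g / s ^ 2], whose first factor is
    [1 - g]. *)
Lemma sum_weight_bounds : (2 <= p)%N ->
  g <= \sum_(1 <= t < p) weight g p t < 1.
Proof.
move=> p2; have := sum_weightE g01 (ltnW p2); case/andP: g01 => g0 g1.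
have fac s : (0 < s)%N -> 0 < 1 - g / (s%:R : R) ^+ 2 <= 1.
  move=> s0; have s1 : 1 <= s%:R ^+ 2 :> R by rewrite exprn_ege1// ler1n.
  have s2 : 0 < s%:R ^+ 2 :> R by lra.
  rewrite subr_gt0 ltr_pdivrMr// mul1r; apply/andP; split; first lra.
  by rewrite gerBl divr_ge0// ltW.
rewrite (@big_ltn _ _ _ 1)// expr1n divr1.
have : 0 < \prod_(2 <= i < p) (1 - g / (i%:R : R) ^+ 2) <= 1.
  rewrite big_nat_cond; elim/big_ind: _ => [|x y /andP[x0 x1] /andP[y0 y1]|i].
  - by rewrite ltr01 lexx.
  - by rewrite mulr_gt0// mulr_ile1// ltW.
  - by move=> /andP[/andP[i2 _] _]; apply: fac; exact: ltnW.
move: (\prod_(2 <= i < p) _) => P /andP[P0 P1] h; apply/andP; split; nra.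
Qed.

Let nat_neq0 (i : nat) : (0 < i)%N -> i%:R != 0 :> R.
Proof. by rewrite pnatr_eq0 lt0n. Qed.

(** Closed form of a partial product below [t]; for [j = t.-1] it starts the
    induction on the upper bound in [prod_all]. *)
Let prod_below t j : (j < t)%N ->
  \prod_(1 <= s < j.+1) (s%:R ^+ 2 / (t%:R ^+ 2 - s%:R ^+ 2)) *
    (t.-1`! * (t + j)`!)%:R = (j`! ^ 2 * (t.-1 - j)`! * t`!)%:R :> R.
Proof.
elim: j => [|j IH] jt.
  by rewrite big_geq// mul1r addn0 subn0 fact0 mul1n.
rewrite big_nat_recr//=; have {}IH := IH (ltnW jt).
have e1 : (t.-1 - j)%N = (t.-1 - j.+1).+1 by lia.
rewrite addnS factS factS.
rewrite e1 [X in (_ * X * _)%N]factS -e1 in IH.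
have d1 : (t%:R ^+ 2 - j.+1%:R ^+ 2 : R) = (t.-1 - j)%:R * (t + j.+1)%:R.
  rewrite subr_sqr [in RHS]natrD; congr (_ * _).
  by rewrite -natrB ?(ltnW jt)//; congr (_%:R); lia.
rewrite d1 addnS.
have n1 : (t.-1 - j)%:R != 0 :> R by apply: nat_neq0; lia.
have n2 : (t + j).+1%:R != 0 :> R by apply: nat_neq0.
move: IH; rewrite !natrM.
move: ((t.-1 - j)%:R : R) ((t + j).+1%:R : R) n1 n2 => A B n1 n2 IH.
apply: (mulfI n1).
transitivity (j.+1%:R ^+ 2 *
  (\prod_(1 <= s < j.+1) (s%:R ^+ 2 / (t%:R ^+ 2 - s%:R ^+ 2)) *
  ((t.-1)`!%:R * (t + j)`!%:R)) : R).
  by field; rewrite n1 n2.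
by rewrite IH; ring.
Qed.

Let prod_all t q : (0 < t)%N -> (t <= q)%N ->
  \prod_(1 <= s < q.+1 | s != t) (s%:R ^+ 2 / `|t%:R ^+ 2 - s%:R ^+ 2|) *
    ((q - t)`! * (q + t)`!)%:R = (2 * q`! ^ 2)%:R :> R.
Proof.
move=> t0; elim: q => [|q IH]; first by rewrite leqn0 eqn0Ngt t0.
rewrite leq_eqVlt => /predU1P[<- {IH q}|tq].
  case: t t0 => // j _.
  rewrite big_mkcond big_nat_recr//= eqxx/= mulr1 subnn fact0 mul1n.
  have h := @prod_below j.+1 j (ltnSn j).
  rewrite [\prod_(1 <= i < j.+1) _](_ : _ = \prod_(1 <= s < j.+1)
      (s%:R ^+ 2 / (j.+1%:R ^+ 2 - s%:R ^+ 2))); last first.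
    apply: eq_big_nat => s /andP[s1 sj]; rewrite neq_ltn sj/=.
    by rewrite ger0_norm// subr_ge0 lerXn2r ?nnegrE// ler_nat ltnW.
  move: h; rewrite -[j.+1.-1]/j subnn fact0 addnS [(j.+1 + j).+1`!]factS.
  have n1 : j`!%:R != 0 :> R by apply: nat_neq0; exact: fact_gt0.
  have d1 : (j.+1 + j).+1 = (2 * j.+1)%N by lia.
  rewrite [(j.+1)`!]factS d1.
  move: (\prod_(1 <= s < j.+1) _) (j`!) ((j.+1 + j)`!) n1 => A B C n1.
  rewrite !natrM => h; apply: (mulfI n1); transitivity
    (2 * j.+1%:R * (A * (B%:R * C%:R))); [ring | rewrite h; ring].
rewrite big_mkcond big_nat_recr//= -big_mkcond/= gtn_eqF//=.
have {}IH := IH tq.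
have e1 : (q.+1 - t)%N = (q - t).+1 by lia.
rewrite e1 addSn !factS.
have d1 : `|t%:R ^+ 2 - q.+1%:R ^+ 2 : R| = (q - t).+1%:R * (q + t).+1%:R.
  rewrite distrC ger0_norm; last first.
    by rewrite subr_ge0 lerXn2r ?nnegrE// ler_nat ltnW.
  rewrite subr_sqr -[(q + t).+1]addSn [in RHS]natrD; congr (_ * _).
  by rewrite -natrB ?(ltnW tq)//; congr (_%:R); lia.
have n1 : (q - t).+1%:R != 0 :> R by apply: nat_neq0.
have n2 : (q + t).+1%:R != 0 :> R by apply: nat_neq0.
rewrite d1; move: IH; rewrite !natrM.
move: ((q - t).+1%:R : R) ((q + t).+1%:R : R) n1 n2 => A B n1 n2 IH.
transitivity (q.+1%:R ^+ 2 *
  (\prod_(1 <= s < q.+1 | s != t) (s%:R ^+ 2 / `|t%:R ^+ 2 - s%:R ^+ 2|) *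
   ((q - t)`!%:R * (q + t)`!%:R)) : R).
  by field; rewrite n1 n2.
by rewrite IH; ring.
Qed.

Let fact_spread q t : (t <= q)%N -> (q`! ^ 2 <= (q - t)`! * (q + t)`!)%N.
Proof.
elim: t => [|t IH] tq; first by rewrite subn0 addn0.
apply: (leq_trans (IH (ltnW tq))).
have -> : (q - t)%N = (q - t.+1).+1 by lia.
by rewrite addnS !factS -mulnA [X in (_ <= X)%N]mulnCA leq_mul2r; apply/orP;
  right; lia.
Qed.

(** The product is [2 * q!^2 / ((q - t)! * (q + t)!)] with [q = p.-1]. *)
Lemma prod_ratio_le2 t : (0 < t)%N -> (t < p)%N ->
  \prod_(1 <= s < p | s != t) (s%:R ^+ 2 / `|t%:R ^+ 2 - s%:R ^+ 2|) <= 2 :> R.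
Proof.
move=> t0 tp; case: p tp => // q; rewrite ltnS => tq.
have := prod_all t0 tq; have := fact_spread tq.
have n0 : (0 < (q - t)`! * (q + t)`!)%N by rewrite muln_gt0 !fact_gt0.
move: n0; set N := (_ * (q + t)`!)%N => n0 le e.
rewrite -(@ler_pM2r _ N%:R) ?ltr0n// e -natrM ler_nat.
by rewrite leq_mul2l le orbT.
Qed.

(** Each factor of the weight is at most [s ^ 2 / |t ^ 2 - s ^ 2|], as
    [0 < g < 1 <= s ^ 2]. *)
Lemma weight_norm_le t : (0 < t)%N -> (t < p)%N ->
  `|weight g p t| <= 2 * g / t%:R ^+ 2.
Proof.
move=> t0 tp; case/andP: g01 => g0 g1.
have gn : g != 0 by rewrite gt_eqF.
have tn : t%:R != 0 :> R := nat_neq0 t0.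
have -> : weight g p t = g / t%:R ^+ 2 * \prod_(1 <= s < p | s != t)
    ((1 - s%:R ^+ 2 / g) / ((t%:R ^+ 2 - s%:R ^+ 2) / g)).
  by rewrite prodf_div /weight invfM invf_div mulrCA.
rewrite normrM ger0_norm; last by rewrite divr_ge0 ?sqr_ge0// ltW.
rewrite [X in _ <= X](_ : _ = g / t%:R ^+ 2 * 2); last by field.
rewrite ler_wpM2l ?divr_ge0 ?sqr_ge0 ?(ltW g0)//.
rewrite normr_prod (le_trans _ (prod_ratio_le2 t0 tp))//.
rewrite big_nat_cond [X in _ <= X]big_nat_cond.
apply: ler_prod => s /andP[/andP[s1 sp] st]; rewrite normr_ge0/=.
have s2 : 1 <= s%:R ^+ 2 :> R by rewrite exprn_ege1// ler1n.
have -> : (1 - s%:R ^+ 2 / g) / ((t%:R ^+ 2 - s%:R ^+ 2) / g) =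
    (g - s%:R ^+ 2) / (t%:R ^+ 2 - s%:R ^+ 2).
  field; rewrite gn andbT subr_eq0 eqrXn2 ?ler0n// eqr_nat eq_sym.
  by rewrite st.
rewrite normrM normfV ler_wpM2r ?invr_ge0//.
by rewrite ler0_norm ?opprB; lra.
Qed.

End WeightBounds.

(** * Taylor expansion of the gradient *)

Section ScalarTaylor.
Context {R : realType}.

Lemma derive_le0_nincr (F dF : R -> R) : (forall t : R, is_derive t 1 F (dF t))
  ->
  (forall t, 0 <= t -> dF t <= 0) -> forall t, 0 <= t -> F t <= F 0.
Proof.
move=> dFP dF0 t t0.
have cF : {within `[0, t], continuous F}.
  by apply: derivable_within_continuous => x _; have [] := dFP x.
have [c /[!in_itv]/= /andP[c0 ct] e] := MVT_segment t0 (fun x _ => dFP x) cF.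
by rewrite -subr_le0 e subr0 mulr_le0_ge0// dF0.
Qed.

Definition taylor_poly (phi : nat -> R -> R) (p : nat) : {poly R} :=
  \poly_(r < p) (phi r 0 / r`!%:R).

Lemma deriv_taylor_poly phi p :
  (taylor_poly phi p.+1)^`() = taylor_poly (phi \o S) p.
Proof.
apply/polyP => i; rewrite coef_deriv !coef_poly ltnS /=.
case: ifP => _; last by rewrite mul0rn.
have n1 : i.+1%:R != 0 :> R by rewrite pnatr_eq0.
have n2 : i`!%:R != 0 :> R by rewrite pnatr_eq0 -lt0n fact_gt0.
rewrite -(mulr_natr (_ / _)) factS natrM.
by move: (i.+1%:R : R) (i`!%:R : R) n1 n2 => a b n1 n2; field; rewrite n1 n2.
Qed.

Lemma taylor_poly_at0 phi p : (taylor_poly phi p.+1).[0] = phi 0 0.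
Proof. by rewrite horner_coef0 coef_poly/= fact0 divr1. Qed.

(** Integrating the Lipschitz bound on the last derivative [p] times; each
    integration is the monotonicity of the error minus its candidate bound. *)
Lemma taylor_remainder_le (L : R) p (phi : nat -> R -> R) :
  (forall j (t : R), (j < p)%N -> is_derive t 1 (phi j) (phi j.+1 t)) ->
  (forall t, 0 <= t -> `|phi p t - phi p 0| <= L * t) ->
  forall t, 0 <= t ->
    `|phi 0 t - (taylor_poly phi p.+1).[t]| <= L * t ^+ p.+1 / p.+1`!%:R.
Proof.
elim: p phi => [|p IH] phi dphi lip t t0.
  rewrite [_.[_]](_ : _ = phi 0 0) ?expr1 ?divr1; first exact: lip.
  by rewrite horner_poly big_ord1 fact0 divr1 expr0 mulr1.
have {}IH s : 0 <= s -> `|phi 1%N s - (taylor_poly (phi \o S) p.+1).[s]| <=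
    L * s ^+ p.+1 / p.+1`!%:R.
  exact: (IH (phi \o S) (fun j s jp => dphi j.+1 s jp) lip).
pose B : {poly R} := (L / p.+2`!%:R) *: 'X^(p.+2).
have BE s : B.[s] = L * s ^+ p.+2 / p.+2`!%:R.
  by rewrite hornerZ hornerXn mulrAC.
have dBE s : B^`().[s] = L * s ^+ p.+1 / p.+1`!%:R.
  rewrite derivZ derivXn hornerZ hornerMn hornerXn -pred_Sn.
  rewrite -(mulr_natr (_ ^+ _)) [p.+2`!]factS natrM.
  have n1 : p.+2%:R != 0 :> R by rewrite pnatr_eq0.
  have n2 : p.+1`!%:R != 0 :> R by rewrite pnatr_eq0 -lt0n fact_gt0.
  move: (p.+2%:R : R) (p.+1`!%:R : R) n1 n2 => a b n1 n2.
  by field; rewrite n1 n2.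
have B0 : B.[0] = 0 by rewrite BE expr0n/= mulr0 mul0r.
set T := taylor_poly phi p.+2.
have T0 : T.[0] = phi 0%N 0 by exact: taylor_poly_at0.
have dT s : T^`().[s] = (taylor_poly (phi \o S) p.+1).[s].
  by rewrite deriv_taylor_poly.
rewrite ler_norml; apply/andP; split.
- have d1 (s : R) : is_derive s 1 (horner (T - B) - phi 0%N)
     ((T - B)^`().[s] - phi 1%N s).
    by apply: is_deriveB; exact: dphi.
  have := @derive_le0_nincr _ _ d1 _ t t0.
  rewrite !fctE !hornerD !hornerN T0 B0 BE oppr0 addr0 subrr => h.
  rewrite lerNl opprB; suff : T.[t] - L * t ^+ p.+2 / p.+2`!%:R - phi 0 t <= 0.
    by lra.
  apply: h => s s0; rewrite derivB hornerD hornerN dBE dT.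
  by have := IH s s0; rewrite ler_norml => /andP[+ _]; lra.
- have d1 (s : R) : is_derive s 1 (phi 0%N - horner (T + B))
     (phi 1%N s - (T + B)^`().[s]).
    by apply: is_deriveB; exact: dphi.
  have := @derive_le0_nincr _ _ d1 _ t t0.
  rewrite !fctE !hornerD T0 B0 BE addr0 subrr => h.
  suff : phi 0 t - (T.[t] + L * t ^+ p.+2 / p.+2`!%:R) <= 0 by lra.
  apply: h => s s0; rewrite derivD hornerD dBE dT.
  by have := IH s s0; rewrite ler_norml => /andP[_ +]; lra.
Qed.

End ScalarTaylor.

Section LineRestriction.
Context {R : realType} {n : nat}.
Implicit Types (f g : 'rV[R]_n -> R) (x u e d : 'rV[R]_n).

Lemma is_derive_line g x e (t : R) : differentiable g (x + t *: e) ->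
  is_derive t 1 (fun s : R => g (x + s *: e)) ('D_e g (x + t *: e)).
Proof.
move=> dg.
have h : (fun h : R => h^-1 *: (g (x + (h *: 1 + t) *: e) - g (x + t *: e))) =
    (fun h : R => h^-1 *: (g (h *: e + (x + t *: e)) - g (x + t *: e))).
  apply/funext => h; congr (_ *: (g _ - _)).
  by rewrite [h *: 1]mulr1 scalerDl addrCA addrA.
have [dd _] : is_derive (x + t *: e) e g ('D_e g (x + t *: e)).
  by apply: derivableP; exact: diff_derivable.
by split; rewrite /derivable /derive; rewrite /= h.
Qed.

Lemma derive_grad f x u : differentiable f x -> 'D_u f x = dot (grad f x) u.
Proof.
move=> df; rewrite deriveE// {1}(row_sum_delta u) linear_sum.
apply: eq_bigr => i _; rewrite linearZ/= mxE deriveE// mulrC.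
by congr (_ * _).
Qed.

Lemma Ck_Dform (hs : seq 'rV[R]_n) j f :
  Ck (size hs + j) f -> Ck j (Dform f hs).
Proof.
elim: hs j => [//|h hs IH] j; rewrite -[size (h :: hs)]/(size hs).+1.
by rewrite addSnnS => /IH[_]; exact.
Qed.

Lemma Ck_differentiable j f x : Ck j.+1 f -> differentiable f x.
Proof. by case. Qed.

End LineRestriction.

Section SmoothnessBounds.
Context {R : realType} {n : nat}.
Variables (f : 'rV[R]_n -> R).
Implicit Types (x u e d : 'rV[R]_n).

(** The quadratic upper bound is the first-order Taylor estimate along the
    segment of the step. *)
Lemma descent_lemma (L1 : R) x e (s : R) : Ck 1 f ->
  (forall y z, enorm (grad f y - grad f z) <= L1 * enorm (y - z)) ->
  enorm e = 1 -> 0 <= s ->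
  f (x + s *: e) <= f x + s * dot (grad f x) e + L1 * s ^+ 2 / 2.
Proof.
move=> f1 lip e1 s0.
have df y : differentiable f y by apply: Ck_differentiable f1.
pose phi (j : nat) (t : R) : R :=
  if j is 0%N then f (x + t *: e) else dot (grad f (x + t *: e)) e.
have := @taylor_remainder_le R L1 1 phi _ _ s s0.
have -> : (taylor_poly phi 2).[s] = f x + s * dot (grad f x) e.
  rewrite horner_poly big_ord_recl big_ord1 /= scale0r !addr0 !divr1.
  by rewrite expr0 expr1 mulr1 mulrC.
rewrite /= => h; suff : `|f (x + s *: e) - (f x + s * dot (grad f x) e)| <=
    L1 * s ^+ 2 / 2 by rewrite ler_norml => /andP[_]; lra.
apply: h => [[|//] t _|t t0].
  by rewrite /= -derive_grad//; exact: is_derive_line.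
rewrite scale0r addr0 -dotNl -dotDl.
have hh (w : 'rV[R]_n) : `|dot w e| <= enorm w.
  by rewrite ler_norml -[enorm w]mulr1 -e1 cauchy_schwarz cauchy_schwarz_ge.
rewrite (le_trans (hh _))// (le_trans (lip _ _))// addrAC subrr add0r enormZ.
by rewrite e1 mulr1 ger0_norm.
Qed.

Variables (p : nat) (Lp : R).
Hypothesis p2 : (2 <= p)%N.
Hypothesis f_Cp : Ck p f.
Hypothesis Dp_lipschitz : forall y z,
  (form_norm (fun h : p.-tuple 'rV[R]_n => (Dform f h y - Dform f h z)%R)
    <= (Lp * enorm (y - z))%R%:E)%E.

Lemma Dform_lipschitz (h : seq 'rV[R]_n) y z : size h = p ->
  (forall v, v \in h -> enorm v <= 1) ->
  `|Dform f h y - Dform f h z| <= Lp * enorm (y - z).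
Proof.
move=> /eqP sh h1.
have le a b : Dform f h a - Dform f h b <= Lp * enorm (a - b).
  rewrite -lee_fin; apply: (le_trans _ (Dp_lipschitz a b)).
  apply: ereal_sup_ubound; exists (Tuple sh) => //= i.
  by apply: h1; rewrite (tnth_nth 0) mem_nth// (eqP sh).
rewrite ler_norml le andbT lerNl opprB (le_trans (le _ _))//.
by rewrite -opprB enormN.
Qed.

(** Along the line of direction [e], the component of the gradient on [u] has the
    successive derivatives [Dform f (nseq r e ++ [:: u])], and the last one is
    Lipschitz because the form of order [p] is evaluated at unit vectors. *)
Lemma grad_taylor x e u : enorm e = 1 -> enorm u = 1 ->
  exists2 Q : {poly R}, (size Q <= p)%N &
    forall t, 0 <= t ->
      `|dot (grad f (x + t *: e)) u - Q.[t]| <= Lp * t ^+ p / p`!%:R.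
Proof.
move=> e1 u1; case: p p2 f_Cp Dform_lipschitz => [//|[//|q]] _ fC lip.
pose phi r (t : R) := Dform f (nseq r e ++ [:: u]) (x + t *: e).
exists (taylor_poly phi q.+2); first exact: size_poly.
have df y : differentiable f y by apply: Ck_differentiable fC.
move=> t t0; rewrite -derive_grad//.
have := @taylor_remainder_le R Lp q.+1 phi _ _ t t0; apply.
- move=> j s jq; rewrite /phi /=; apply: is_derive_line.
  apply: (@Ck_differentiable _ _ (q - j)); apply: Ck_Dform.
  rewrite size_cat size_nseq/=.
  by rewrite (_ : (_ + _)%N = q.+2)//; move: jq; lia.
- move=> s s0; rewrite /phi.
  apply: (le_trans (lip _ _ _ _ _)).
  + by rewrite size_cat size_nseq addn1.
  + move=> v; rewrite mem_cat mem_nseq inE => /orP[/andP[_ /eqP->]|/eqP->].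
      by rewrite e1.
    by rewrite u1.
  + by rewrite scale0r addr0 addrAC subrr add0r enormZ e1 mulr1 ger0_norm.
Qed.

Hypothesis Lp0 : 0 < Lp.

(** The weights extrapolate the Taylor polynomial exactly, so that only the
    remainders at the nodes and at [1] are left. *)
Lemma extrapolation_bias (g : R) x d : 0 < g < 1 ->
  enorm ((1 - \sum_(1 <= t < p) weight g p t) *: grad f x
         + \sum_(1 <= t < p) weight g p t *: grad f (x + node g t *: d)
         - grad f (x + d))
  <= Lp * enorm d ^+ p / p`!%:R *
     (1 + \sum_(1 <= t < p) `|weight g p t| * node g t ^+ p).
Proof.
move=> g01; set w := weight g p; set S := \sum_(1 <= t < p) w t.
have nn t : 0 <= node g t by rewrite divr_ge0 ?sqr_ge0//; case/andP: g01; lra.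
have C0 : 0 <= Lp * enorm d ^+ p / p`!%:R.
  by rewrite divr_ge0// mulr_ge0 ?exprn_ge0 ?enorm_ge0// ltW.
have rhs0 : 0 <= Lp * enorm d ^+ p / p`!%:R *
     (1 + \sum_(1 <= t < p) `|w t| * node g t ^+ p).
  by rewrite mulr_ge0// addr_ge0// sumr_ge0// => t _;
    rewrite mulr_ge0 ?exprn_ge0.
have [->|d0] := eqVneq d 0.
  under eq_bigr do rewrite scaler0 addr0.
  by rewrite addr0 -scaler_suml -scalerDl subrK scale1r subrr enorm0
    expr0n gtn_eqF ?(ltnW p2)//= mulr0 !mul0r.
set s := enorm d in C0 rhs0 *; pose e := s^-1 *: d.
have s0 : 0 < s by exact: enorm_gt0.
have dE a : a *: d = (s * a) *: e.
  by rewrite scalerA mulrAC mulfV ?gt_eqF// mul1r.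
apply: enorm_le_dual => // u u1.
have [Q sQ HQ] := grad_taylor x (enorm_normalize d0) u1.
rewrite -/s -/e in HQ.
(* the Taylor polynomial in the parameter that is [1] at the end of [d] *)
pose Q' : {poly R} := \poly_(i < p) (Q`_i * s ^+ i).
have Q'E a : Q'.[a] = Q.[s * a].
  rewrite horner_poly (horner_coef_wide _ sQ); apply: eq_bigr => i _.
  by rewrite exprMn mulrA.
have ex : Q.[s] = (1 - S) * Q.[0] + \sum_(1 <= t < p) w t * Q.[s * node g t].
  under eq_bigr do rewrite -Q'E.
  have := weight_exact g01 (ltnW p2) (size_poly p (fun i => Q`_i * s ^+ i)).
  by rewrite -/Q' !Q'E mulr0 mulr1.
have rem a : 0 <= a -> `|dot (grad f (x + a *: d)) u - Q.[s * a]| <=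
    Lp * s ^+ p / p`!%:R * a ^+ p.
  move=> a0; rewrite dE (le_trans (HQ _ _))// ?mulr_ge0 ?(ltW s0)//.
  by rewrite exprMn; lra.
have r0 : dot (grad f x) u = Q.[0].
  have := rem 0 (lexx _);
    rewrite scale0r addr0 mulr0 expr0n gtn_eqF ?(ltnW p2)//.
  by rewrite mulr0 normr_le0 subr_eq0 => /eqP.
have r1 := rem 1 ler01; rewrite scale1r mulr1 expr1n mulr1 in r1.
rewrite !dotDl dotNl dotZl dot_suml r0.
under eq_bigr do rewrite dotZl.
apply: (@le_trans _ _ ((Q.[s] - dot (grad f (x + d)) u) +
   \sum_(1 <= t < p) w t * (dot (grad f (x + node g t *: d)) u - Q.[s * node g
     t]))).
  under [X in _ <= _ + X]eq_bigr do rewrite mulrBr.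
  by rewrite sumrB ex; lra.
rewrite mulrDr mulr1; apply: lerD.
  by move: r1; rewrite ler_norml => /andP[+ _]; lra.
rewrite mulr_sumr; apply: ler_sum => t _.
rewrite (le_trans (ler_norm _))// normrM [X in _ <= X]mulrCA ler_wpM2l//.
exact: rem.
Qed.

End SmoothnessBounds.

Section ExtrapolationConstant.
Context {R : realType}.

(** The node [t] contributes at most [2 * t ^ (2 * p - 2) / g ^ (p - 1)]: the
    factor [t ^ -2] of the weight offsets one power of [node g t]. *)
Lemma weight_moment_le (g : R) p : 0 < g < 1 -> (2 <= p)%N ->
  1 + \sum_(1 <= t < p) `|weight g p t| * node g t ^+ p <=
    p%:R ^+ (2 * p) / g ^+ p.-1.
Proof.
move=> g01 p2; case: p p2 => [//|[//|q]] _ /=.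
have [g0 g1] : 0 < g /\ g <= 1 by case/andP: g01; lra.
set p := q.+2.
have gq : 0 < g ^+ q.+1 by rewrite exprn_gt0.
have p1 : 1 <= p%:R :> R by rewrite ler1n.
have term t : (1 <= t < p)%N ->
    `|weight g p t| * node g t ^+ p <= 2 * p%:R ^+ (2 * q.+1) / g ^+ q.+1.
  move=> /andP[t1 tp].
  have t0 : t%:R != 0 :> R by rewrite pnatr_eq0 -lt0n.
  apply: (@le_trans _ _ (2 * g / t%:R ^+ 2 * node g t ^+ p)).
    rewrite ler_wpM2r ?weight_norm_le// exprn_ge0// divr_ge0 ?sqr_ge0//.
    exact: ltW.
  have -> : 2 * g / t%:R ^+ 2 * node g t ^+ p =
      2 * t%:R ^+ (2 * q.+1) / g ^+ q.+1.
    rewrite /node /p [X in _ * X]exprS exprMn exprVn -exprM; field.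
    by rewrite t0 expf_neq0 ?gt_eqF.
  rewrite ler_wpM2r ?invr_ge0 ?(ltW gq)// ler_wpM2l// lerXn2r ?nnegrE//.
  by rewrite ler_nat ltnW.
apply: (@le_trans _ _ (1 + \sum_(1 <= t < p)
    (2 * p%:R ^+ (2 * q.+1) / g ^+ q.+1))).
  by rewrite lerD2l; apply: ler_sum_nat => t; exact: term.
rewrite sumr_const_nat subn1 -[p.-1]/q.+1 -(mulr_natr (_ / _)) [_ / _ *
  _]mulrAC.
rewrite -(@ler_pM2r _ (g ^+ q.+1))// mulrDl !mulfVK ?gt_eqF// mul1r.
apply: (@le_trans _ _ (1 + 2 * p%:R ^+ (2 * q.+1) * q.+1%:R)).
  by rewrite lerD2r exprn_ile1// ltW.
have -> : (2 * p = (2 * q.+1).+2)%N by rewrite /p; lia.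
move: (2 * q.+1)%N => N; have h : 1 <= p%:R ^+ N :> R by rewrite exprn_ege1.
rewrite !exprSr.
set A := p%:R ^+ _ in h *.
have -> : q.+1%:R = p%:R - 1 :> R by rewrite /p -[q.+2%:R]natr1 addrK.
have A0 : 0 <= A by lra.
have := mulr_ge0 A0 (sqr_ge0 (p%:R - 1)); rewrite expr2; lra.
Qed.

End ExtrapolationConstant.

(** * Measurability of vector-valued maps *)

Section VectorMeasurability.
Context {R : realType} {n : nat} {d : measure_display} {T : measurableType d}.
Implicit Types (v w : T -> 'rV[R]_n) (c : T -> R) (f : 'rV[R]_n -> R).

(** Measurability for the product sigma-algebra, read off the coordinates. *)
Definition vmeasurable v := forall i, measurable_fun setT (fun t => v t ord0 i).

Lemma vmeasurable_cst (a : 'rV[R]_n) : vmeasurable (fun=> a).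
Proof. by move=> i; exact: measurable_cst. Qed.

Lemma vmeasurableD v w : vmeasurable v -> vmeasurable w ->
  vmeasurable (fun t => v t + w t).
Proof.
move=> mv mw i; under eq_fun do rewrite mxE.
exact: measurable_funD.
Qed.

Lemma vmeasurableZ c v : measurable_fun setT c -> vmeasurable v ->
  vmeasurable (fun t => c t *: v t).
Proof.
move=> mc mv i; under eq_fun do rewrite mxE.
exact: measurable_funM.
Qed.

Lemma vmeasurableN v : vmeasurable v -> vmeasurable (fun t => - v t).
Proof.
move=> mv; under eq_fun do rewrite -scaleN1r.
by apply: vmeasurableZ => //; exact: measurable_cst.
Qed.

Lemma vmeasurable_sum (I : Type) (r : seq I) (F : I -> T -> 'rV[R]_n) :
  (forall i, vmeasurable (F i)) -> vmeasurable (fun t => \sum_(i <- r) F i t).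
Proof.
move=> mF j; under eq_fun do rewrite summxE.
by apply: measurable_sum => i; exact: mF.
Qed.

Lemma measurable_enorm v : vmeasurable v -> measurable_fun setT (fun t =>
  enorm (v t)).
Proof.
move=> mv; apply: (@measurableT_comp _ _ _ _ _ _ (@Num.sqrt R)).
  by apply: continuous_measurable_fun; exact: sqrt_continuous.
by apply: measurable_sum => i; apply: measurable_funX; exact: mv.
Qed.

(** An open set of row vectors is the union of the cubes with rational centre
    and radius [j.+1^-1] that it contains, and there are countably many. *)
Lemma measurable_continuous_comp f v : continuous f -> vmeasurable v ->
  measurable_fun setT (f \o v).
Proof.
move=> cf mv; apply: (measurability _ (RGenOInfty.measurableE R)).
move=> /= _ [_ [r ->]] <-; rewrite setTI comp_preimage.
set U := f @^-1` _.
have oU : open U by apply: open_comp => [x _|];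
  [exact: cf|exact: interval_open].
pose cube (b : 'rV[rat]_n * nat) : set 'rV[R]_n :=
  [set y | forall i, `|y ord0 i - ratr (b.1 ord0 i)| < b.2.+1%:R^-1].
have mcube b : measurable (v @^-1` cube b).
  have -> : v @^-1` cube b = ~` \bigcup_(i in [set: 'I_n])
      ~` [set t | `|v t ord0 i - ratr (b.1 ord0 i)| < b.2.+1%:R^-1].
    rewrite setC_bigcup; apply/seteqP; split=> t /= h i; first by move=> _;
      rewrite setCK; apply: h.
    by have := h i I; rewrite setCK.
  apply: measurableC; apply: fin_bigcup_measurable => // i _;
    apply: measurableC.
  rewrite -[X in measurable X]setTI.
  apply: (@measurable_fun_ltr _ _ _ _ (fun t =>
    `|v t ord0 i - ratr (b.1 ord0 i)|) (fun=> b.2.+1%:R^-1)).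
  - apply: measurableT_comp => //; apply: measurable_funB; first exact: mv.
    exact: measurable_cst.
  - exact: measurable_cst.
  - exact: measurableT.
  - by [].
have -> : v @^-1` U = \bigcup_b (if `[< cube b `<=` U >] then v @^-1` cube b
  else set0).
  apply/seteqP; split => [t Ut|t [b _]]; last first.
    by case: asboolP => // bU /bU.
  have /nbhs_ballP[e /= e0 be] : nbhs (v t) U by rewrite nbhsE/=; exists U.
  have [j [s [sE s0 se]]] : exists j : nat, exists s : R,
      [/\ j.+1%:R^-1 = s, 0 < s & 2 * s < e].
    have /ltr_add_invr[j jP] : 0 < e / 2 by rewrite divr_gt0.
    exists j, j.+1%:R^-1; split=> //.
    by rewrite add0r ltr_pdivlMr// mulrC in jP.
  have /choice[q qP] : forall i : 'I_n, exists q : rat,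
      `|v t ord0 i - ratr q| < s.
    move=> i; have [] := @rat_in_itvoo R (v t ord0 i - s) (v t ord0 i + s).
      by lra.
    move=> q; rewrite in_itv/= => /andP[q1 q2]; exists q.
    by rewrite ltr_norml; lra.
  exists (\row_i q i, j) => //; case: asboolP => [_ /= i|/=].
    by rewrite mxE sE.
  case=> y yq; apply: be; split=> //= i0 i; rewrite (ord1 i0).
  by have := yq i; have := qP i; rewrite /= mxE sE /ball/= !ltr_norml; lra.
apply: countable_bigcupT_measurable => [|b]; first exact: countableP.
by case: ifP.
Qed.

End VectorMeasurability.

(** * Integration against an independent sample *)

Section IndependentIntegration.
Context {R : realType} {d d' : measure_display} {Om : measurableType d}
  {Xi : measurableType d'} {P : probability Om R}.
Local Open Scope ereal_scope.

(** If [Y] is independent of the events of [<<s G >>], the law of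
    [w |-> (w, Y w)] on the product of [(Om, <<s G >>)] with the range of [Y] is
    a product measure, whence Tonelli evaluates the expectation by freezing [w]
    in the first argument. *)
Lemma integral_independent (G : set (set Om)) (Y : {RV P >-> Xi})
    (h : (g_sigma_algebraType G * Xi)%type -> \bar R) :
  G `<=` measurable ->
  (forall E B, <<s G >> E -> measurable B ->
    P (E `&` Y @^-1` B) = P E * P (Y @^-1` B)) ->
  measurable_fun setT h -> (forall u, 0 <= h u) ->
  \int[P]_w h (w, Y w) = \int[P]_w \int[distribution P Y]_y h (w, y).
Proof.
move=> Gm indep mh h0.
have sGm := smallest_sub (@sigma_algebra_measurable _ Om) Gm.
pose past : Om -> g_sigma_algebraType G := id.
have mpast : measurable_fun setT past by move=> _ B mB; rewrite setTI;
  exact: sGm.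
pose past_rv : {RV P >-> g_sigma_algebraType G} :=
  HB.pack past (isMeasurableFun.Build _ _ _ _ past mpast).
pose joint (w : Om) : (g_sigma_algebraType G * Xi)%type := (past w, Y w).
have mjoint : measurable_fun setT joint by exact: measurable_fun_pair.
pose joint_rv : {RV P >-> (g_sigma_algebraType G * Xi)%type} :=
  HB.pack joint (isMeasurableFun.Build _ _ _ _ joint mjoint).
have prodE B : measurable B ->
    (distribution P past_rv \x distribution P Y) B = distribution P joint_rv B.
  by apply: product_measure_unique => A C mA mC; exact: indep.
transitivity (\int[distribution P joint_rv]_u h u).
  by rewrite ge0_integral_distribution.
transitivity (\int[distribution P past_rv \x distribution P Y]_u h u).
  by apply: eq_measure_integral => B mB _; exact/esym/prodE.
rewrite fubini_tonelli1// ge0_integral_distribution//.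
- exact: measurable_fun_fubini_tonelli_F.
- by move=> w; apply: integral_ge0.
Qed.

End IndependentIntegration.

Section SampleIndependence.
Context {R : realType} {d d' : measure_display} {Om : measurableType d}
  {Xi : measurableType d'} {P : probability Om R}.
Variable X : nat -> {RV P >-> Xi}.
Local Open Scope ereal_scope.

Definition past_events (k : nat) : set (set Om) :=
  [set E | exists j A, [/\ (j < k)%N, measurable A & E = X j @^-1` A]].

Lemma past_events_measurable k : past_events k `<=` measurable.
Proof.
move=> _ [j [A [_ mA ->]]]; rewrite -[X in measurable X]setTI.
exact: measurable_funPT.
Qed.

Hypothesis indep : mutually_independent X.

(** The cylinders [\bigcap_(j < k) X j @^-1` A j] form a pi-system generating the
    past, on which mutual independence is the claim. *)
Lemma independent_past k E (B : set Xi) :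
  <<s past_events k >> E -> measurable B ->
  P (E `&` X k @^-1` B) = P E * P (X k @^-1` B).
Proof.
move=> sE mB.
have mX j A : measurable A -> measurable (X j @^-1` A).
  by move=> mA; rewrite -[X in measurable X]setTI; exact: measurable_funPT.
have mC : measurable (X k @^-1` B) by exact: mX.
pose J : {fset nat} := [fset j in iota 0 k]%fset.
have JP j : (j \in J) = (j < k)%N by rewrite inE/= mem_iota.
pose cyl : set (set Om) := [set F | exists A : nat -> set Xi,
  (forall j, measurable (A j)) /\ F = \bigcap_(j in [set` J]) X j @^-1` A j].
have mcyl : cyl `<=` measurable.
  move=> _ [A [mA ->]]; apply: fin_bigcap_measurable => //= j _.
  exact: mX.
have cylT : cyl setT.
  exists (fun=> setT); split; first by move=> j; exact: measurableT.
  by apply/seteqP; split.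
have cylI : setI_closed cyl.
  move=> _ _ [A1 [mA1 ->]] [A2 [mA2 ->]]; exists (fun j => A1 j `&` A2 j);
    split.
    by move=> j; exact: measurableI.
  by rewrite -bigcapI.
have sub : <<s past_events k >> `<=` <<s cyl >>.
  apply: smallest_sub; first exact: smallest_sigma_algebra.
  move=> _ [j [A [jk mA ->]]]; apply: sub_sigma_algebra.
  exists (fun i => if i == j then A else setT); split.
    by move=> i; case: ifP => // _; exact: measurableT.
  apply/seteqP; split=> [w Aw i _ /=|w /(_ j)]; first by case: eqP => [->|].
  by rewrite /= eqxx; apply; rewrite JP.
have PC0 : (0 <= fine (P (X k @^-1` B)))%R by rewrite fine_ge0// measure_ge0.
have PCE : (fine (P (X k @^-1` B)))%:E = P (X k @^-1` B).
  by rewrite fineK// fin_num_measure.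
pose m2 := mscale (NngNum PC0) P.
have m2E F : m2 F = P F * P (X k @^-1` B).
  by rewrite -PCE muleC.
transitivity (mrestr P mC E); first by [].
rewrite -m2E.
apply: (@g_sigma_algebra_measure_unique _ R Om cyl mcyl (fun=> setT)
  (fun=> cylT) _ (mrestr P mC) m2 cylI _ _ E (sub _ sE)).
- by rewrite bigcup_const.
- move=> _ [A [mA ->]].
  transitivity (P (\bigcap_(j in [set` J]) X j @^-1` A j) * P (X k @^-1` B));
    last exact/esym/m2E.
  pose A' j := if j == k then B else A j.
  have mA' j : measurable (A' j) by rewrite /A'; case: ifP.
  have kJ : k \notin J by rewrite JP ltnn.
  have eJ j : j \in J -> A' j = A j by rewrite JP /A' => /ltn_eqF ->.
  transitivity (P (\bigcap_(j in [set` (k |` J)%fset]) X j @^-1` A' j)).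
    congr (P _); apply/seteqP; split=> [w [Aw Bw] j /=|w Aw].
      rewrite in_fsetU in_fset1 => /orP[/eqP->|jJ]; first by rewrite /A' eqxx.
      by rewrite eJ//; exact: Aw.
    split; first by move=> j jJ; rewrite -(eJ j)//; apply: Aw;
      rewrite /= in_fsetU jJ orbT.
    by have := Aw k; rewrite /A' eqxx; apply; rewrite /= in_fsetU in_fset1 eqxx.
  rewrite !indep// big_fsetU1//= {1}/A' eqxx muleC; congr (_ * _).
  by apply: eq_big_seq => j jJ; rewrite eJ.
- by move=> _; rewrite /= /mrestr setTI (le_lt_trans (probability_le1 _ _))//
  ltry.
Qed.

End SampleIndependence.

Section UniformIndex.
Context {R : realType} {d d' : measure_display} {Om : measurableType d}
  {Xi : measurableType d'} {P : probability Om R}.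
Variables (X : nat -> {RV P >-> Xi}) (iota : {RV P >-> nat}) (K : nat).
Local Open Scope ereal_scope.

Definition all_events : set (set Om) :=
  [set E | exists j A, measurable A /\ E = X j @^-1` A].

Hypothesis K0 : (0 < K)%N.
Hypothesis iota_unif : uniform_index K iota.
Hypothesis iota_indep : independent_of_samples iota X.

(** Freezing the sample path leaves the average of [g] over the law of [iota],
    which charges only [{0, ..., K.-1}]. *)
Lemma integral_uniform_index (g : nat -> Om -> R) :
  (forall k w, 0 <= g k w)%R ->
  (forall k, measurable_fun setT (g k : g_sigma_algebraType all_events -> R)) ->
  \int[P]_w (g (iota w) w)%:E =
    \sum_(k < K) (K%:R^-1)%:E * \int[P]_w (g k w)%:E.
Proof.
move=> g0 mg.
have sGm : <<s all_events >> `<=` @measurable _ Om.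
  apply: smallest_sub; first exact: sigma_algebra_measurable.
  move=> _ [j [A [mA ->]]]; rewrite -[X in measurable X]setTI.
  exact: measurable_funPT.
have mgO k : measurable_fun setT (g k).
  move=> _ B mB; rewrite setTI; apply: sGm.
  by have := mg k measurableT B mB; rewrite setTI.
have miota (B : set nat) : measurable (iota @^-1` B).
  by rewrite -[X in measurable X]setTI; exact: measurable_funPT.
have mgi : measurable_fun setT (fun w => g (iota w) w).
  move=> _ B mB; rewrite setTI.
  have -> : (fun w => g (iota w) w) @^-1` B =
      \bigcup_k (iota @^-1` [set k] `&` g k @^-1` B).
    apply/seteqP; split=> [w Bw|w [k _ [/= <-]]//]; first by exists (iota w).
  apply: bigcupT_measurable => k; apply: measurableI => //.
  by rewrite -[X in measurable X]setTI; exact: mgO.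
have mone k : measurable_fun setT (fun w => (iota w == k)%:R : R).
  rewrite (_ : (fun w => _) = \1_(iota @^-1` [set k]));
    first exact: measurable_indic.
  by apply/funext => w; rewrite indicE; congr ((nat_of_bool _)%:R);
    apply/idP/idP => [/eqP|/set_mem/=->//]; rewrite inE.
have piece k : (k < K)%N ->
    \int[P]_w ((iota w == k)%:R * g k w)%:E = (K%:R^-1)%:E * \int[P]_w (g k
      w)%:E.
  move=> kK.
  pose h (u : g_sigma_algebraType all_events * nat) : \bar R :=
    ((u.2 == k)%:R * g k u.1)%:E.
  have mh : measurable_fun setT h.
    apply/measurable_EFinP; apply: measurable_funM.
      have mk : measurable_fun setT (fun j : nat => (j == k)%:R : R) by [].
      exact: (measurableT_comp mk measurable_snd).
    by apply: (measurableT_comp (mg k)).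
  transitivity (\int[P]_w h (w, iota w)); first by [].
  rewrite (@integral_independent _ _ _ _ _ _ all_events)//; last 3 first.
  - move=> _ [j [A [mA ->]]]; rewrite -[X in measurable X]setTI.
    exact: measurable_funPT.
  - by move=> E B sE _; rewrite setIC iota_indep// muleC.
  - by move=> u; rewrite lee_fin mulr_ge0.
  have inner w : \int[distribution P iota]_y h (w, y) = (K%:R^-1)%:E * (g k
    w)%:E.
    rewrite /h/=; under eq_integral do rewrite EFinM muleC.
    rewrite ge0_integralZl//; last by rewrite lee_fin.
    rewrite muleC; congr (_ * _).
    rewrite (_ : (fun j => _) = EFin \o \1_[set k]); last first.
      apply/funext => j /=; rewrite indicE; congr ((nat_of_bool _)%:R%:E).
      by apply/idP/idP => [/eqP|/set_mem/=->//]; rewrite inE.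
    by rewrite integral_indic// setIT; exact: iota_unif.
  under eq_integral do rewrite inner.
  rewrite ge0_integralZl//.
  - by apply/measurable_EFinP.
  - by move=> w _; rewrite lee_fin.
transitivity (\int[P]_w (\sum_(k < K) ((iota w == k)%:R * g k w))%:E).
  apply: ae_eq_integral => //.
  - exact/measurable_EFinP.
  - apply/measurable_EFinP; apply: measurable_sum => k.
    by apply: measurable_funM => //; exact: mone.
  exists (iota @^-1` [set j | (K <= j)%N]); split=> //.
    have -> : iota @^-1` [set j | (K <= j)%N] =
        ~` (\big[setU/set0]_(k < K) iota @^-1` [set (k : nat)]).
      rewrite -(bigcup_mkord K (fun k => iota @^-1` [set k])); apply/seteqP;
        split=> [w /= Kw [k kK /= e]|w /= h].
        by move: kK; rewrite -e /= ltnNge Kw.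
      by rewrite leqNgt; apply/negP => wK; apply: h; exists (iota w).
    transitivity (1 - P (\big[setU/set0]_(k < K) iota @^-1` [set (k : nat)])).
      by apply: probability_setC; exact: bigsetU_measurable.
    rewrite measure_bigsetU_ord//=; last first.
      by move=> i j _ _ [w [/= e1 e2]]; apply: val_inj;
        exact: etrans (esym e1) e2.
    under eq_bigr do rewrite iota_unif//.
    rewrite sumEFin sumr_const card_ord -[(_ *+ _)%R]mulr_natr mulVf ?subee//.
    by rewrite pnatr_eq0 -lt0n.
  move=> w /= nw; rewrite leqNgt; apply/negP => wK; apply: nw => _.
  congr (_%:E); rewrite (bigD1 (Ordinal wK))//= eqxx mul1r big1 ?addr0//.
  by move=> k; rewrite -val_eqE/= eq_sym => /negPf ->; rewrite mul0r.
under eq_integral do rewrite -sumEFin.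
rewrite ge0_integral_sum//; first by apply: eq_bigr => k _; exact: piece.
- by move=> k; apply/measurable_EFinP; apply: measurable_funM.
- by move=> k w _; rewrite lee_fin mulr_ge0.
Qed.

End UniformIndex.

(** * Moments of the stochastic gradient noise *)

Section NoiseMoment.
Context {R : realType} {n : nat} {d d' : measure_display}
  {Om : measurableType d} {Xi : measurableType d'} {P : probability Om R}.
Variables (G : 'rV[R]_n -> Xi -> 'rV[R]_n) (b : 'rV[R]_n -> 'rV[R]_n).
Variables (xi : {RV P >-> Xi}) (alpha sigma : R).
Hypothesis sigma0 : 0 <= sigma.
Hypothesis G_meas : jointly_measurable G.

Lemma vmeasurable_estimator (d2 : measure_display) (T : measurableType d2)
    (z : T -> 'rV[R]_n) (e : T -> Xi) :
  vmeasurable z -> measurable_fun setT e -> vmeasurable (fun t =>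
    G (z t) (e t)).
Proof.
move=> mz me i.
have mt : measurable_fun setT (fun t => ([tuple z t ord0 j | j < n], e t)).
  apply: measurable_fun_pair => //; apply/measurable_fun_tnthP => j.
  by rewrite (_ : _ \o _ = fun t => z t ord0 j)//; apply/funext => t /=;
    rewrite tnth_mktuple.
have := measurableT_comp (G_meas i) mt.
rewrite (_ : _ \o _ = fun t => G (z t) (e t) ord0 i)//; apply/funext => t /=.
by congr (G _ _ _ _); apply/rowP => j; rewrite mxE tnth_mktuple.
Qed.

Definition centered (h : Om -> R) : Prop :=
  P.-integrable setT (EFin \o h) /\ (\int[P]_w (h w)%:E = 0)%E.

Lemma centeredZ c h : centered h -> centered (fun w => c * h w).
Proof.
move=> [ih h0]; split.
  by apply: eq_integrable (integrableZl measurableT c ih).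
by under eq_integral do rewrite EFinM; rewrite integralZl// h0 mule0.
Qed.

Lemma centered_sum (I : Type) (r : seq I) (h : I -> Om -> R) :
  (forall i, centered (h i)) -> centered (fun w => \sum_(i <- r) h i w).
Proof.
move=> ch; elim: r => [|i r [IH1 IH2]].
  split; first by apply: eq_integrable (integrable0 P setT) => // w _ /=;
    rewrite big_nil.
  by under eq_integral do rewrite big_nil; rewrite integral0.
have [ih h0] := ch i; split.
  apply: eq_integrable (integrableD measurableT ih IH1) => // w _.
  by rewrite /= big_cons.
under eq_integral do rewrite big_cons EFinD.
by rewrite integralD// h0 IH2 adde0.
Qed.

Hypothesis alpha12 : 1 <= alpha <= 2.
Hypothesis G_unbiased : forall y (i : 'I_n),
  ('E_P[fun w => G y (xi w) ord0 i] = (b y ord0 i)%:E)%E.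
Hypothesis G_moment : forall y,
  ('E_P[fun w => (enorm (G y (xi w) - b y) `^ alpha)%R] <= (sigma `^
    alpha)%R%:E)%E.

Let noise y w := G y (xi w) - b y.

Let a0 : 0 <= alpha. Proof. by case/andP: alpha12 => a1 _; lra. Qed.

Lemma measurable_powR_enorm (d2 : measure_display) (T : measurableType d2)
    (v : T -> 'rV[R]_n) :
  vmeasurable v -> measurable_fun setT (fun t => enorm (v t) `^ alpha).
Proof.
move=> mv; apply: (@measurableT_comp _ _ _ _ _ _ (fun x => x `^ alpha)).
  exact: measurable_powR.
exact: measurable_enorm.
Qed.

Let mnoise y : vmeasurable (noise y).
Proof.
apply: vmeasurableD; last exact: vmeasurable_cst.
by apply: vmeasurable_estimator => //; exact: vmeasurable_cst.
Qed.

Let noise_moment y :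
  (\int[P]_w (enorm (noise y w) `^ alpha)%:E <= (sigma `^ alpha)%:E)%E.
Proof. by have := G_moment y; rewrite unlock. Qed.

Let integrable_noise_moment y :
  P.-integrable setT (fun w => (enorm (noise y w) `^ alpha)%:E).
Proof.
apply/integrableP; split.
  by apply/measurable_EFinP; exact: measurable_powR_enorm.
under eq_integral do rewrite abse_EFin ger0_norm ?powR_ge0//.
by rewrite (le_lt_trans (noise_moment y))// ltry.
Qed.

Lemma noise_centered y i : centered (fun w => noise y w ord0 i).
Proof.
have int : P.-integrable setT (EFin \o (fun w => noise y w ord0 i)).
  apply: (@le_integrable _ _ _ P setT _ _
    (fun w => (1 + enorm (noise y w) `^ alpha)%:E)) => //.
  - by apply/measurable_EFinP; exact: mnoise.
  - move=> w _; rewrite /= lee_fin (le_trans (coord_le_enorm _ _))//.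
    rewrite [X in _ <= X]ger0_norm ?addr_ge0 ?powR_ge0//.
    case/andP: alpha12 => a1 _; have [e1|e1] := leP (enorm (noise y w)) 1.
      by have := powR_ge0 (enorm (noise y w)) alpha; lra.
    by have := le1r_powR (ltW e1) a1; lra.
  - under eq_fun do rewrite EFinD; apply: integrableD => //.
    exact: finite_measure_integrable_cst.
split=> //.
have := G_unbiased y i; rewrite unlock.
have -> : (fun w => (G y (xi w) ord0 i)%:E) =
    (fun w => (noise y w ord0 i)%:E + (b y ord0 i)%:E)%E.
  by apply/funext => w; rewrite -EFinD !mxE subrK.
rewrite integralD//; last exact: finite_measure_integrable_cst.
rewrite integral_cst//= probability_setT mule1.
rewrite -[X in (_ = X)%E]add0e => /(congr1 (fun r => r - (b y ord0 i)%:E)%E).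
by rewrite !addeK.
Qed.

(** The first-order term of [enormD_powR] is centered, so that only the moment
    of the noise itself is added to that of [u]. *)
Lemma noisy_moment_le (p : nat) (w : nat -> R) (z : nat -> 'rV[R]_n)
    (u : 'rV[R]_n) (C : R) : (2 <= p)%N -> 0 <= C ->
  (forall t, (1 <= t < p)%N -> `|w t| <= C) ->
  (\int[distribution P xi]_y
     (enorm (u + \sum_(1 <= t < p) w t *: (G (z t) y - b (z t))) `^ alpha)%:E
   <= (enorm u `^ alpha + 6 * (C * p.-1%:R * sigma) `^ alpha)%:E)%E.
Proof.
move=> p2 C0 wC; set N := fun e =>
  \sum_(1 <= t < p) w t *: (G (z t) e - b (z t)).
have mN (d2 : measure_display) (T : measurableType d2) (e : T -> Xi) :
    measurable_fun setT e -> vmeasurable (fun t => N (e t)).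
  move=> me; apply: vmeasurable_sum => t; apply: vmeasurableZ.
    exact: measurable_cst.
  apply: vmeasurableD; last exact: vmeasurable_cst.
  by apply: vmeasurable_estimator => //; exact: vmeasurable_cst.
rewrite ge0_integral_distribution; last 2 first.
- apply/measurable_EFinP; apply: measurable_powR_enorm; apply: vmeasurableD.
    exact: vmeasurable_cst.
  exact: (mN _ _ id).
- by move=> e; rewrite lee_fin powR_ge0.
have alpha1 : 1 <= alpha by case/andP: alpha12.
pose q := p.-1; have q0 : 0 < q%:R :> R by rewrite ltr0n /q -subn1 subn_gt0.
pose S (om : Om) := \sum_(1 <= t < p) enorm (noise (z t) om) `^ alpha.
pose D := 6 * (C `^ alpha * q%:R `^ (alpha - 1)).
have D0 : 0 <= D by rewrite mulr_ge0// mulr_ge0// powR_ge0.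
pose L om := alpha * (enorm u `^ (alpha - 2) * dot u (N (xi om))).
have size_r : size (index_iota 1 p) = q by rewrite size_iota subn1.
have ptw om : enorm (u + N (xi om)) `^ alpha <= enorm u `^ alpha + L om + D * S
  om.
  apply: (le_trans (enormD_powR _ _ alpha12)); rewrite lerD2l /D -mulrA.
  apply: ler_wpM2l => //.
  have h1 : enorm (N (xi om)) <= C * \sum_(1 <= t < p) enorm (noise (z t) om).
    rewrite (le_trans (enorm_sum _ _ _))// mulr_sumr; apply: ler_sum_nat =>
      t tp.
    by rewrite enormZ ler_wpM2r ?enorm_ge0// wC.
  apply: (@le_trans _ _ ((C * \sum_(1 <= t < p) enorm (noise (z t) om)) `^
    alpha)).
    rewrite ge0_ler_powR ?nnegrE ?enorm_ge0//.
    by rewrite mulr_ge0// sumr_ge0// => t _; exact: enorm_ge0.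
  rewrite powRM//; last by rewrite sumr_ge0// => t _; exact: enorm_ge0.
  rewrite -mulrA ler_wpM2l ?powR_ge0// /S -size_r.
  apply: powR_sum => //; last by move=> t; exact: enorm_ge0.
  by rewrite size_r -(ltr0n R).
have [iL L0] : centered L.
  apply: centeredZ; apply: centeredZ.
  rewrite (_ : (fun om => _) = fun om => \sum_(1 <= t < p) w t *
      \sum_(i < n) u ord0 i * noise (z t) om ord0 i); last first.
    by apply/funext => om; rewrite dotC dot_suml; apply: eq_bigr => t _;
      rewrite dotZl dotC.
  apply: centered_sum => t; apply: centeredZ; apply: centered_sum => i.
  by apply: centeredZ; exact: noise_centered.
have iS : P.-integrable setT (EFin \o S).
  have : P.-integrable setT (fun om =>
    \sum_(1 <= t < p) (enorm (noise (z t) om) `^ alpha)%:E)%E.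
    exact: integrable_sum.
  by apply: eq_integrable => // om _; rewrite /= sumEFin.
have iA : P.-integrable setT (fun om => (enorm u `^ alpha)%:E + (L om)%:E)%E.
  by apply: integrableD => //; exact: finite_measure_integrable_cst.
have iDS : P.-integrable setT (fun om => D%:E * (S om)%:E)%E.
  exact: integrableZl.
have S_le : (\int[P]_om (S om)%:E <= (q%:R * sigma `^ alpha)%:E)%E.
  under eq_integral do rewrite -sumEFin.
  rewrite ge0_integral_sum//.
  - apply: (@le_trans _ _ (\sum_(1 <= t < p) (sigma `^ alpha)%:E)%E).
      by apply: lee_sum => t _; exact: noise_moment.
    by rewrite sumEFin sumr_const_nat subn1 -[(_ *+ _)%R]mulr_natl.
  - by move=> t; apply/measurable_EFinP; exact: measurable_powR_enorm.
  - by move=> t om _; rewrite lee_fin powR_ge0.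
apply: (@le_trans _ _ (\int[P]_om (((enorm u `^ alpha)%:E + (L om)%:E) + D%:E *
  (S om)%:E))%E).
  apply: ge0_le_integral => //.
  - by move=> om _; rewrite lee_fin powR_ge0.
  - apply/measurable_EFinP; apply: measurable_powR_enorm; apply: vmeasurableD.
      exact: vmeasurable_cst.
    exact: mN.
  - by move: (integrableD measurableT iA iDS) => /integrableP[].
  - by move=> om _; rewrite -EFinM -!EFinD lee_fin; exact: ptw.
rewrite integralD// integralD//; last exact: finite_measure_integrable_cst.
rewrite L0 adde0 integral_cst//= probability_setT mule1 EFinD leeD2l//.
rewrite integralZl//; apply: (le_trans (lee_wpmul2l _ S_le));
  first by rewrite lee_fin.
rewrite -EFinM lee_fin /D -[X in X <= _]mulrA ler_wpM2l//.
rewrite !powRM ?mulr_ge0 ?(ltW q0)//.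
rewrite -[X in _ <= _ * X * _](mulr_powRB1 (ltW q0)); last lra.
by rewrite le_eqVlt; apply/orP; left; apply/eqP; ring.
Qed.

End NoiseMoment.

(** * Descent and momentum error along the trajectory *)

Section Trajectory.
Context {R : realType} {n : nat} {d d' : measure_display}
  {Om : measurableType d} {Xi : measurableType d'} {P : probability Om R}.
Variables (f : 'rV[R]_n -> R) (G : 'rV[R]_n -> Xi -> 'rV[R]_n).
Variables (xi : {RV P >-> Xi}) (xis : nat -> {RV P >-> Xi}).
Variables (p : nat) (eta g : nat -> R) (x0 : 'rV[R]_n).
Variables (x m : nat -> Om -> 'rV[R]_n).
Hypothesis f_C1 : Ck 1 f.
Hypothesis G_meas : jointly_measurable G.
Hypothesis p2 : (2 <= p)%N.
Hypothesis path : forall w,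
  multi_extrapolated_path G x0 p.-1 eta (fun k t => g k / t%:R ^+ 2)
    (fun k t => weight (g k) p t) (fun k => xis k w)
    (fun k => x k w) (fun k => m k w).

Lemma vmeasurable_grad (d2 : measure_display) (T : measurableType d2)
    (v : T -> 'rV[R]_n) : vmeasurable v -> vmeasurable (fun t => grad f (v t)).
Proof.
move=> mv i; under eq_fun do rewrite mxE.
apply: (@measurable_continuous_comp _ _ _ _ (fun y =>
  'D_(delta_mx ord0 i) f y)) => //.
by case: f_C1 => _ ; exact.
Qed.

(** The measurability of the state is needed for several sigma-algebras, which
    differ from that of [Om]; [phi] pulls the sample path back to any space on
    which the samples drawn so far are measurable. *)
Lemma path_measurable (d2 : measure_display) (T : measurableType d2)
    (phi : T -> Om) k :
  (forall j, (j < k)%N -> measurable_fun setT (xis j \o phi)) ->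
  [/\ vmeasurable (fun t => x k (phi t)),
      vmeasurable (fun t => lag x0 (fun k => x k (phi t)) k) &
      vmeasurable (fun t => lag 0 (fun k => m k (phi t)) k)].
Proof.
elim: k => [|k IH] mxis.
  split; [|exact: vmeasurable_cst..].
  by under eq_fun do rewrite (path_init (path _)); exact: vmeasurable_cst.
have [mx mlx mlm] := IH (fun j jk => mxis j (ltnW jk)).
have mm : vmeasurable (fun t => m k (phi t)).
  under eq_fun do rewrite (path_momentum (path _)).
  apply: vmeasurableD.
    by apply: vmeasurableZ => //; exact: measurable_cst.
  apply: vmeasurable_sum => t; apply: vmeasurableZ; first exact: measurable_cst.
  apply: vmeasurable_estimator => //; last exact: mxis.
  apply: vmeasurableD => //; apply: vmeasurableZ; first exact: measurable_cst.
  by apply: vmeasurableD => //; exact: vmeasurableN.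
split=> //.
under eq_fun do rewrite (path_step (path _)).
apply: vmeasurableD => //; apply: vmeasurableN; apply: vmeasurableZ => //.
apply: measurable_funM; first exact: measurable_cst.
under eq_fun do rewrite -powR_inv1 ?enorm_ge0//.
exact: measurable_powR_enorm.
Qed.

Hypothesis eta0 : forall k, 0 < eta k.

Lemma step_length k w : enorm (x k.+1 w - x k w) <= eta k.
Proof.
rewrite (path_step (path w)) addrAC subrr add0r enormN enormZ.
have [->|/enorm_gt0 m0] := eqVneq (m k w) 0.
  by rewrite enorm0 mulr0 ltW.
rewrite ger0_norm ?divr_ge0 ?(ltW m0) ?(ltW (eta0 _))//.
by rewrite mulfVK// gt_eqF.
Qed.

(** The descent lemma in the direction [- v / |v|] with [v = m k w], together with
    [dot (grad f) v / |v| >= |grad f| - 2 * |v - grad f|]. If [v = 0] the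
      iterate
    does not move, and the momentum error is the whole gradient. *)
Lemma one_step_descent (L1 : R) k w : 0 < L1 ->
  (forall y z, enorm (grad f y - grad f z) <= L1 * enorm (y - z)) ->
  eta k * enorm (grad f (x k w)) <= f (x k w) - f (x k.+1 w)
    + 2 * eta k * enorm (m k w - grad f (x k w)) + L1 * eta k ^+ 2 / 2.
Proof.
move=> L10 lip; rewrite (path_step (path w)).
set y := x k w; set v := m k w; set e := eta k.
have e0 : 0 < e := eta0 k.
have tr : enorm (grad f y) <= enorm v + enorm (v - grad f y).
  rewrite -{1}(subKr v (grad f y)) (le_trans (enormD _ _))//.
  by rewrite enormN.
have [v0|v0] := eqVneq v 0.
  rewrite v0 scaler0 subr0 subrr add0r; rewrite v0 enorm0 in tr.
  have := mulr_ge0 (ltW L10) (sqr_ge0 e).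
  have := ler_wpM2l (ltW e0) tr;
    have := mulr_ge0 (ltW e0) (enorm_ge0 (0 - grad f y)); lra.
have ev0 := enorm_gt0 v0.
have := descent_lemma y f_C1 lip (e := - ((enorm v)^-1 *: v)) _ (ltW e0).
rewrite enormN enorm_normalize// => /(_ erefl).
rewrite scalerN scalerA dotNr dotZr.
have cs := cauchy_schwarz (v - grad f y) v.
have h : enorm v - enorm (v - grad f y) <= (enorm v)^-1 * dot (grad f y) v.
  rewrite ler_pdivlMl//; rewrite dotDl dotNl dotvv in cs.
  by rewrite expr2 in cs; lra.
have h2 : e * (enorm (grad f y) - 2 * enorm (v - grad f y)) <=
    e * ((enorm v)^-1 * dot (grad f y) v).
  by rewrite ler_wpM2l ?(ltW e0)//; lra.
by set E := enorm (v - _) in h2 *; lra.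
Qed.

Hypothesis g01 : forall k, 0 < g k < 1.

Lemma extrapolation_node k t w : (0 < t)%N ->
  extrapolation (fun k t => g k / t%:R ^+ 2) x0 (fun k => x k w) k.+1 t =
  x k w + node (g k) t *: (x k.+1 w - x k w).
Proof.
move=> t0; rewrite /extrapolation /=.
have gn : g k != 0 by rewrite gt_eqF//; case/andP: (g01 k).
have tn : t%:R != 0 :> R by rewrite pnatr_eq0 -lt0n.
have -> : (1 - g k / t%:R ^+ 2) / (g k / t%:R ^+ 2) = node (g k) t - 1.
  by rewrite /node; field; rewrite gn tn.
by apply/rowP => i; rewrite !mxE; ring.
Qed.

Variables (Lp alpha sigma : R).
Hypothesis f_Cp : Ck p f.
Hypothesis Lp0 : 0 < Lp.
Hypothesis Dp_lipschitz : forall y z,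
  (form_norm (fun h : p.-tuple 'rV[R]_n => (Dform f h y - Dform f h z)%R)
    <= (Lp * enorm (y - z))%R%:E)%E.
Hypothesis alpha12 : 1 < alpha <= 2.
Hypothesis sigma0 : 0 < sigma.

(** The part of the next momentum error that the past determines: the damped
    current error and the bias of the extrapolation. *)
Let drift k w : 'rV[R]_n :=
  let S := \sum_(1 <= t < p) weight (g k) p t in
  (1 - S) *: (m k w - grad f (x k w)) +
  ((1 - S) *: grad f (x k w) + \sum_(1 <= t < p) weight (g k) p t *:
     grad f (x k w + node (g k) t *: (x k.+1 w - x k w)) - grad f (x k.+1 w)).

Lemma momentum_error_succ k w :
  m k.+1 w - grad f (x k.+1 w) = drift k w + \sum_(1 <= t < p) weight (g k) p t
    *:
    (G (x k w + node (g k) t *: (x k.+1 w - x k w)) (xis k.+1 w)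
     - grad f (x k w + node (g k) t *: (x k.+1 w - x k w))).
Proof.
rewrite (path_momentum (path w)) prednK ?(ltnW p2)//=.
under [X in _ = _ + X]eq_bigr do rewrite scalerBr.
rewrite sumrB /drift.
under [X in _ *: m k w + X - _ = _]eq_big_nat => t /andP[t0 _] do
  rewrite extrapolation_node//.
move: (\sum_(1 <= t < p) _ *: grad f _) (\sum_(1 <= t < p) _ *: G _ _) => A B.
set c := 1 - _; rewrite scalerBr.
by apply/rowP => i; rewrite !mxE; ring.
Qed.

Definition bias_bound k : R :=
  Lp * eta k ^+ p / p`!%:R * (p%:R ^+ (2 * p) / g k ^+ p.-1).

Let bias_bound_ge0 k : 0 <= bias_bound k.
Proof.
case/andP: (g01 k) => gk _.
by rewrite !mulr_ge0 ?invr_ge0 ?exprn_ge0 ?ler0n ?(ltW Lp0) ?(ltW (eta0 k))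
  ?(ltW gk).
Qed.

(** The drift is dominated by the convex combination of the previous error with
    weight [1 - S] and of [bias / S] with weight [S], where [S >= g k]. *)
Lemma drift_powR_le k w : enorm (drift k w) `^ alpha <=
  (1 - g k) * enorm (m k w - grad f (x k w)) `^ alpha
  + g k `^ (1 - alpha) * bias_bound k `^ alpha.
Proof.
have /andP[gS S1] := sum_weight_bounds (g01 k) p2.
case/andP: (g01 k) => g0 g1; case/andP: alpha12 => a1 a2.
rewrite /drift; set S := \sum_(1 <= t < p) _ in gS S1 *.
set dl := m k w - _; set B := (X in (_ + X)%R).
have S0 : 0 < S by lra.
have bB : enorm B <= bias_bound k.
  have := extrapolation_bias p2 f_Cp Dp_lipschitz Lp0 (x k w)
    (x k.+1 w - x k w) (g01 k).
  rewrite [x k w + (x k.+1 w - x k w)]addrC subrK => /le_trans; apply.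
  have C0 : 0 <= Lp / p`!%:R by rewrite divr_ge0// ltW.
  rewrite /bias_bound; apply: ler_pM.
  - by rewrite mulr_ge0 ?invr_ge0// mulr_ge0 ?(ltW Lp0)// exprn_ge0// enorm_ge0.
  - rewrite addr_ge0// sumr_ge0// => t _; rewrite mulr_ge0// exprn_ge0//.
    by rewrite divr_ge0 ?sqr_ge0// ltW.
  - rewrite ler_wpM2r ?invr_ge0// ler_wpM2l ?(ltW Lp0)//.
    by rewrite lerXn2r ?nnegrE ?enorm_ge0 ?(ltW (eta0 k))// step_length.
  - exact: weight_moment_le.
have B0 := bias_bound_ge0 k.
have S1' : 0 <= 1 - S by lra.
have BS := divr_ge0 B0 (ltW S0).
apply: (@le_trans _ _ (((1 - S) * enorm dl + S * (bias_bound k / S)) `^ alpha)).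
  rewrite ge0_ler_powR ?nnegrE ?enorm_ge0//; first lra.
    exact: addr_ge0 (mulr_ge0 S1' (enorm_ge0 _)) (mulr_ge0 (ltW S0) BS).
  rewrite (le_trans (enormD _ _))// enormZ ger0_norm; last lra.
  by rewrite lerD2l mulrC mulfVK// gt_eqF.
have S01 : 0 <= S <= 1 by lra.
apply: (le_trans (powR_convex (ltW a1) S01 (enorm_ge0 _) BS)).
apply: lerD.
  by rewrite ler_wpM2r ?powR_ge0//; lra.
rewrite powRM ?invr_ge0 ?(ltW S0)// mulrCA [X in _ <= X]mulrC ler_wpM2l
  ?powR_ge0//.
rewrite -powR_inv1 ?(ltW S0)// -powRrM mulN1r -{1}(powRr1 (ltW S0)).
rewrite -powRD ?(gt_eqF S0) ?implybT//.
have e y : y `^ (1 - alpha) = (y `^ (alpha - 1))^-1 by rewrite -powRN opprB.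
rewrite !e lef_pV2 ?posrE ?powR_gt0//.
by rewrite ge0_ler_powR ?nnegrE ?(ltW g0) ?(ltW S0)//; lra.
Qed.

Hypothesis xis_law : forall k, same_distribution (xis k) xi.
Hypothesis xis_indep : mutually_independent xis.
Hypothesis G_unbiased : forall y (i : 'I_n),
  ('E_P[fun w => G y (xi w) ord0 i] = (grad f y ord0 i)%:E)%E.
Hypothesis G_moment : forall y,
  ('E_P[fun w => (enorm (G y (xi w) - grad f y) `^ alpha)%R]
    <= (sigma `^ alpha)%R%:E)%E.

Lemma vmeasurable_momentum_error (d2 : measure_display) (T : measurableType d2)
    (phi : T -> Om) k :
  (forall j, (j < k.+1)%N -> measurable_fun setT (xis j \o phi)) ->
  vmeasurable (fun t => m k (phi t) - grad f (x k (phi t))).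
Proof.
move=> mxis; have [_ mx mm] := path_measurable mxis.
apply: vmeasurableD; first exact: mm.
by apply: vmeasurableN; apply: vmeasurable_grad; exact: mx.
Qed.

Let error_moment k : \bar R :=
  (\int[P]_w (enorm (m k w - grad f (x k w)) `^ alpha)%:E)%E.

Lemma error_moment0 : (error_moment 0 <= (sigma `^ alpha)%:E)%E.
Proof.
have m0E w : m 0 w = G x0 (xis 0%N w).
  rewrite (path_momentum (path w)) prednK ?(ltnW p2)//= scaler0 add0r.
  rewrite /extrapolation/= subrr mul0r scale0r addr0 (path_init (path w)).
  rewrite -scaler_suml sumr_const_nat subn1 -[_ *+ _]mulr_natr mulVf ?scale1r//.
  by rewrite pnatr_eq0 -lt0n -subn1 subn_gt0.
have mh : measurable_fun setT (fun e =>
  (enorm (G x0 e - grad f x0) `^ alpha)%:E).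
  apply/measurable_EFinP; apply: measurable_powR_enorm.
  apply: vmeasurableD; last exact: vmeasurable_cst.
  by apply: vmeasurable_estimator => //; exact: vmeasurable_cst.
have h0 e : (0 <= (enorm (G x0 e - grad f x0) `^ alpha)%:E)%E.
  by rewrite lee_fin powR_ge0.
have lawE : (\int[P]_w (enorm (G x0 (xis 0%N w) - grad f x0) `^ alpha)%:E =
    \int[P]_w (enorm (G x0 (xi w) - grad f x0) `^ alpha)%:E)%E.
  transitivity (\int[distribution P (xis 0%N)]_e
      (enorm (G x0 e - grad f x0) `^ alpha)%:E)%E.
    by rewrite (ge0_integral_distribution (xis 0%N) mh h0).
  transitivity (\int[distribution P xi]_e
      (enorm (G x0 e - grad f x0) `^ alpha)%:E)%E.
    by apply: eq_measure_integral => A mA _; exact: xis_law.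
  by rewrite (ge0_integral_distribution xi mh h0).
have -> : error_moment 0 =
    (\int[P]_w (enorm (G x0 (xis 0%N w) - grad f x0) `^ alpha)%:E)%E.
  by apply: eq_integral => w _; rewrite m0E (path_init (path w)).
by rewrite lawE; have := G_moment x0; rewrite unlock.
Qed.

(** With the past frozen the drift is a constant vector to which the fresh
    sample adds a centered noise. *)
Lemma error_moment_succ k : (error_moment k.+1 <=
  (1 - g k)%:E * error_moment k + (g k `^ (1 - alpha) * bias_bound k `^ alpha
     + 6 * (2 * g k * p.-1%:R * sigma) `^ alpha)%:E)%E.
Proof.
case/andP: (g01 k) => g0 g1; case/andP: alpha12 => a1 a2.
pose F := past_events xis k.+1.
pose T := g_sigma_algebraType F.
pose z t w := x k w + node (g k) t *: (x k.+1 w - x k w).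
pose h (u : T * Xi) : \bar R := (enorm (drift k u.1 + \sum_(1 <= t < p)
  weight (g k) p t *: (G (z t u.1) u.2 - grad f (z t u.1))) `^ alpha)%:E.
have mxis j : (j < k.+1)%N ->
    measurable_fun setT (xis j \o (fst : T * Xi -> Om)).
  move=> jk; have mj : measurable_fun setT (xis j : T -> Xi).
    move=> _ B mB; rewrite setTI; apply: sub_sigma_algebra.
    by exists j, B.
  exact: (measurableT_comp mj measurable_fst).
have mxisO j : measurable_fun setT (xis j \o (id : Om -> Om)).
  exact: measurable_funPT.
have [mx1 mx mm] := path_measurable mxis.
have mz t : vmeasurable (fun u : T * Xi => z t u.1).
  apply: vmeasurableD; first exact: mx.
  apply: vmeasurableZ; first exact: measurable_cst.
  by apply: vmeasurableD => //; apply: vmeasurableN; exact: mx.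
have mdrift : vmeasurable (fun u : T * Xi => drift k u.1).
  have mgx := vmeasurable_grad mx.
  apply: vmeasurableD.
    apply: vmeasurableZ; first exact: measurable_cst.
    exact: vmeasurable_momentum_error.
  apply: vmeasurableD; last by apply: vmeasurableN; exact: vmeasurable_grad.
  apply: vmeasurableD.
    by apply: vmeasurableZ => //; exact: measurable_cst.
  apply: vmeasurable_sum => t; apply: vmeasurableZ; first exact: measurable_cst.
  exact: vmeasurable_grad (mz t).
have mh : measurable_fun setT h.
  apply/measurable_EFinP; apply: measurable_powR_enorm; apply: vmeasurableD =>
    //.
  apply: vmeasurable_sum => t; apply: vmeasurableZ; first exact: measurable_cst.
  apply: vmeasurableD; last by apply: vmeasurableN;
    exact: vmeasurable_grad (mz t).
  by apply: vmeasurable_estimator => //; exact: mz.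
have -> : error_moment k.+1 = (\int[P]_w h (w, xis k.+1 w))%E.
  by apply: eq_integral => w _; rewrite momentum_error_succ.
rewrite (integral_independent (@past_events_measurable _ _ _ _ _ P xis
  k.+1))//; last 2 first.
- by move=> E B; exact: independent_past.
- by move=> u; rewrite lee_fin powR_ge0.
set c := 6 * _ `^ alpha.
have a12 : 1 <= alpha <= 2 by lra.
have inner w : (\int[distribution P (xis k.+1)]_y h (w, y) <=
    (enorm (drift k w) `^ alpha + c)%:E)%E.
  rewrite (eq_measure_integral (distribution P xi)); last first.
    by move=> A mA _; exact: xis_law.
  have g20 : 0 <= 2 * g k by rewrite mulr_ge0// ltW.
  have := @noisy_moment_le _ _ _ _ _ _ _ _ _ _ _ _ (ltW sigma0) G_meas a12
    G_unbiased G_moment p (weight (g k) p) (z^~ w) (drift k w) _ p2 g20.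
  apply; move=> t /andP[t1 tp];
    rewrite (le_trans (weight_norm_le (g01 k) t1 tp))//.
  rewrite ler_pdivrMr ?exprn_gt0 ?ltr0n// ler_peMr//.
  by rewrite exprn_ege1// ler1n.
have mhO : measurable_fun setT (fun w =>
  (enorm (m k w - grad f (x k w)) `^ alpha)%:E).
  apply/measurable_EFinP; apply: measurable_powR_enorm.
  exact: (@vmeasurable_momentum_error _ _ id).
apply: (@le_trans _ _ (\int[P]_w ((1 - g k)%:E *
    (enorm (m k w - grad f (x k w)) `^ alpha)%:E +
    (g k `^ (1 - alpha) * bias_bound k `^ alpha + c)%:E))%E).
  apply: ge0_le_integral => //.
  - by move=> w _; apply: integral_ge0 => y _; rewrite lee_fin powR_ge0.
  - move=> _ B mB; rewrite setTI.
    have sFm : <<s F >> `<=` @measurable _ Om.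
      apply: smallest_sub; first exact: sigma_algebra_measurable.
      exact: (@past_events_measurable _ _ _ _ _ P xis k.+1).
    have mF : measurable_fun [set: T]
        (fun w : T => \int[distribution P (xis k.+1)]_y h (w, y))%E.
      apply: measurable_fun_fubini_tonelli_F => // u.
      by rewrite lee_fin powR_ge0.
    by apply: sFm; have := mF measurableT B mB; rewrite setTI.
  - by apply: emeasurable_funD => //; apply: measurable_funeM.
  - move=> w _; apply: (le_trans (inner w));
    rewrite -EFinM -EFinD lee_fin addrA.
    by rewrite lerD2r drift_powR_le.
have c0 : 0 <= g k `^ (1 - alpha) * bias_bound k `^ alpha + c.
  by rewrite addr_ge0 ?mulr_ge0 ?powR_ge0.
rewrite ge0_integralD//.
- rewrite ge0_integralZl//; last by rewrite lee_fin; lra.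
    by rewrite integral_cst//= probability_setT mule1.
  by move=> w _; rewrite lee_fin powR_ge0.
- by move=> w _; rewrite mule_ge0// lee_fin ?powR_ge0//; lra.
- by apply: measurable_funeM.
Qed.

Lemma error_moment_le (r : nat -> R) : sigma `^ alpha <= r 0%N ->
  (forall k, (1 - g k) * r k + (g k `^ (1 - alpha) * bias_bound k `^ alpha
     + 6 * (2 * g k * p.-1%:R * sigma) `^ alpha) <= r k.+1) ->
  forall k, (\int[P]_w (enorm (m k w - grad f (x k w)) `^ alpha)%:E <= (r
    k)%:E)%E.
Proof.
move=> r0 rS; elim=> [|k IH].
  by apply: (le_trans error_moment0); rewrite lee_fin.
apply: (le_trans (error_moment_succ k)).
apply: (@le_trans _ _ (((1 - g k) * r k)%:E + (g k `^ (1 - alpha) * bias_bound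
  k `^ alpha
     + 6 * (2 * g k * p.-1%:R * sigma) `^ alpha)%:E)%E).
  rewrite leeD2r// EFinM lee_wpmul2l// lee_fin subr_ge0 ltW//.
  by case/andP: (g01 k).
by rewrite -EFinD lee_fin.
Qed.

End Trajectory.

(** * Logarithms and decay rates *)

Section Logarithms.
Context {R : realType}.
Implicit Types (b c y : R).

Lemma ln_ge1 y : 4 <= y -> 1 <= ln y.
Proof.
move=> y4; have y0 : 0 < y by lra.
rewrite -ler_expR lnK ?posrE//; apply: le_trans y4.
(* [expR 1 <= 4], the inverse square of [expR (- 1 / 2) >= 1 / 2] *)
have e0 := expR_gt0 (- (2^-1 : R)); have := @expR_ge1Dx R (- 2^-1).
have e1 : expR 1 * (expR (- 2^-1) * expR (- 2^-1)) = 1 :> R.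
  by rewrite -!expRD (_ : 1 + _ = 0) ?expR0//; lra.
move=> h2; have hh : 4^-1 <= expR (- 2^-1) * expR (- 2^-1) :> R by nra.
by have := ler_wpM2l (expR_ge0 (1 : R)) hh; lra.
Qed.

(** The sum is at most [ln ((K + 3) / 3)] by comparison with a telescoping sum of
    logarithms. *)
Lemma harmonic_le_ln K : (2 <= K)%N ->
  \sum_(k < K) (k + 4)%:R^-1 <= ln K%:R :> R.
Proof.
move=> K2; have step (k : nat) :
    (k + 4)%:R^-1 <= ln (k.+1 + 3)%:R - ln (k + 3)%:R :> R.
  have e : (k.+1 + 3)%N = (k + 4)%N by lia.
  have k4 : 0 < (k + 4)%:R :> R by rewrite ltr0n addnS.
  have k3 : 0 < (k + 3)%:R :> R by rewrite ltr0n addnS.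
  rewrite e -ln_div ?posrE// -[X in ln X]invf_div lnV ?posrE ?divr_gt0// lerNr.
  have E : (k + 4)%:R = (k + 3)%:R + 1 :> R by rewrite natr1 addnS.
  rewrite (_ : (k + 3)%:R / (k + 4)%:R = 1 + - (k + 4)%:R^-1); last first.
    have : (k + 3)%:R + 1 != 0 :> R by rewrite -E gt_eqF.
    by rewrite E; move: ((k + 3)%:R : R) => u u1; field.
  apply: le_ln1Dx; rewrite ltrN2 invf_lt1// ltr1n; lia.
apply: (@le_trans _ _ (ln (K + 3)%:R - ln 3%:R)).
  rewrite -(big_mkord xpredT (fun k => (k + 4)%:R^-1)).
  have <- : \sum_(0 <= k < K) (ln (k.+1 + 3)%:R - ln (k + 3)%:R) =
      ln (K + 3)%:R - ln 3%:R :> R.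
    exact: (telescope_sumr (fun k => ln (k + 3)%:R : R) (leq0n K)).
  by apply: ler_sum_nat => k _; exact: step.
rewrite -ln_div ?posrE ?ltr0n ?addnS// ler_ln ?posrE ?divr_gt0 ?ltr0n ?addnS//;
  last by lia.
rewrite ler_pdivrMr ?ltr0n// -natrM ler_nat; lia.
Qed.

(** With [v = c * ln c], the tangent of [ln] at [v] and [ln v <= 2 * ln c] give
    [c * ln y <= 2 * v + y / ln c - c]. *)
Lemma mul_ln_le c y : 4 <= c -> c * ln c <= y -> c * ln y <= 4 * y.
Proof.
move=> c4; have l1 := ln_ge1 c4; have c0 : 0 < c by lra.
set v := c * ln c => vy.
have v0 : 0 < v by rewrite mulr_gt0//; lra.
have y0 : 0 < y by lra.
have lv : ln v <= 2 * ln c.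
  rewrite /v lnM ?posrE//; last lra.
  by have := @ln_sublinear R (ln c) ltac:(lra); lra.
have ly : ln y <= ln v + (y / v - 1).
  rewrite -lerBlDl -ln_div ?posrE// -[X in ln X](subrKC 1) le_ln1Dx//.
  have := divr_gt0 y0 v0; lra.
have cyv : c * (y / v) <= y.
  have -> : c * (y / v) = y / ln c by rewrite /v; field; rewrite !gt_eqF//; lra.
  by rewrite ler_pdivrMr ?ler_peMr//; lra.
have clv : c * ln v <= 2 * y.
  apply: (@le_trans _ _ (2 * v)); last lra.
  by rewrite /v mulrCA ler_wpM2l//; lra.
have := ler_wpM2l (ltW c0) ly; rewrite mulrDr mulrBr; lra.
Qed.

End Logarithms.

Section Rates.
Context {R : realType}.
Variables (p : nat) (alpha : R).
Hypothesis p2 : (2 <= p)%N.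
Hypothesis alpha12 : 1 < alpha <= 2.

Let D := rate_denom p alpha.
Local Notation P := (p%:R : R).
Let P2 : 2 <= P. Proof. by rewrite ler_nat. Qed.
Let DE : D = P * (2 * alpha - 1) + alpha - 1. Proof. by []. Qed.
Let a1 : 1 < alpha. Proof. by case/andP: alpha12. Qed.
Let a2 : alpha <= 2. Proof. by case/andP: alpha12. Qed.
Let Pa : 0 <= (P - 2) * (alpha - 1).
Proof. by rewrite mulr_ge0//; [have := P2|have := a1]; lra. Qed.
Let D0 : 0 < D. Proof. by rewrite DE; have := Pa; have := a1; have := P2;
  lra. Qed.
Lemma rate_denom_gt0 : 0 < rate_denom p alpha. Proof. exact: D0. Qed.
Let Dn : D != 0. Proof. by rewrite gt_eqF. Qed.

(** Exponents of the step sizes, of the extrapolation parameters, and of the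
    weight that the momentum error receives in the potential function. *)
Definition eta_exp : R := (P * alpha + alpha - 1) / D.
Definition gamma_exp : R := P * alpha / D.
Definition pot_exp : R := (alpha - 1) * (P * (alpha - 1) - 1) / D.

Definition pot (k : nat) : R := (k + 4)%:R `^ pot_exp.

Local Notation y k := ((k + 4)%:R : R).
Local Notation eta := (eta_seq p alpha).
Local Notation gam := (gamma_seq p alpha).

Let y4 k : 4 <= y k. Proof. by rewrite ler_nat leq_addl. Qed.
Let y0 k : 0 < y k. Proof. have := y4 k; lra. Qed.

Lemma etaE k : eta k = y k `^ (- eta_exp).
Proof. by rewrite /eta_seq div1r powRN. Qed.

Lemma gammaE k : gam k = y k `^ (- gamma_exp).
Proof. by rewrite /gamma_seq div1r powRN. Qed.

Lemma eta_gt0 k : 0 < eta k.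
Proof. by rewrite etaE powR_gt0. Qed.

Lemma pot_gt0 k : 0 < pot k.
Proof. by rewrite powR_gt0. Qed.

Lemma gamma_exp_bounds : 0 < gamma_exp <= 1.
Proof.
have P_ := P2; have Pa_ := Pa; have a1_ := a1.
by rewrite divr_gt0//= ?ler_pdivrMr// ?mul1r ?DE; lra.
Qed.

Lemma eta_expE : eta_exp = 1 - P * (alpha - 1) / D.
Proof. by rewrite /eta_exp DE; field; rewrite -DE. Qed.

Lemma eta_exp_bounds : 0 < eta_exp <= 1.
Proof.
have P_ := P2; have Pa_ := Pa; have a1_ := a1.
rewrite divr_gt0//=; last by lra.
by rewrite ler_pdivrMr// mul1r DE; lra.
Qed.

Lemma gamma_gt0_lt1 k : 0 < gam k < 1.
Proof.
have /andP[g0 g1] := gamma_exp_bounds.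
rewrite gammaE powR_gt0//= powRN invf_lt1 ?powR_gt0//.
rewrite /powR gt_eqF// pexpR_gt1// mulr_gt0// ln_gt0//.
by have := y4 k; lra.
Qed.

Lemma inv_le_gamma k : (y k)^-1 <= gam k.
Proof.
have /andP[g0 g1] := gamma_exp_bounds.
rewrite gammaE -powR_inv1 ?(ltW (y0 k))// ler_powR//; last lra.
by have := y4 k; lra.
Qed.

Lemma pot_exp_le : pot_exp <= 1 / 3.
Proof.
rewrite /pot_exp ler_pdivrMr// DE.
have a1_ := a1; have a2_ := a2; have P0 : 0 <= P by have := P2; lra.
have h : 0 <= (alpha - 1) * (2 - alpha) by rewrite mulr_ge0//; lra.
have h1 : (alpha - 1) * (alpha - 1) <= (2 * alpha - 1) / 3 by lra.
by have := ler_wpM2l P0 h1; lra.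
Qed.

Lemma pot0_le : pot 0 <= 4 `^ (1 / 3).
Proof. by rewrite ler_powR ?pot_exp_le//; lra. Qed.

(** Bernoulli's inequality, with [pot_exp <= 1 / 3] and [(k + 4)^-1 <= gam k];
    growth by less than a third of [gam k] leaves a contraction by [2 / 3 * gam
      k]
    in [pot_contraction]. *)
Lemma pot_succ_le k : pot k.+1 <= (1 + gam k / 3) * pot k.
Proof.
have ig := inv_le_gamma k; have iv0 : 0 < (y k)^-1 by rewrite invr_gt0.
have yS : y k.+1 = y k * (1 + (y k)^-1).
  by rewrite mulrDr mulr1 mulfV ?gt_eqF// natr1 addSn.
rewrite /pot yS; move: (y k)^-1 ig iv0 => v ig v0.
rewrite powRM ?(ltW (y0 k))//; last lra.
rewrite mulrC ler_wpM2r ?powR_ge0//.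
have [s0|s0] := leP pot_exp 0.
  apply: (@le_trans _ _ 1); last by lra.
  rewrite -[X in _ <= X](powRr0 (1 + v)) ler_powR//; lra.
have s3 := pot_exp_le.
apply: (le_trans (@bernoulli_powR _ pot_exp v _ _)); [lra|lra|].
rewrite lerD2l; have := ler_wpM2l (ltW s0) ig.
by have := ler_wpM2r (ltW (lt_le_trans v0 ig)) s3; lra.
Qed.

Lemma pot_contraction k : pot k.+1 * (1 - gam k) <= pot k * (1 - 2 / 3 * gam k).
Proof.
have /andP[g0 g1] := gamma_gt0_lt1 k; have w0 := pot_gt0 k.
have g1' : 0 <= 1 - gam k by lra.
have := ler_wpM2r g1' (pot_succ_le k).
have := mulr_ge0 (ltW w0) (sqr_ge0 (gam k)); nra.
Qed.

Lemma pot_succ_le2 k : pot k.+1 <= 2 * pot k.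
Proof.
have /andP[g0 g1] := gamma_gt0_lt1 k; have w0 := pot_gt0 k.
by have := pot_succ_le k; nra.
Qed.

Let ypD k (u v : R) : y k `^ u * y k `^ v = y k `^ (u + v).
Proof. by rewrite powRD// (gt_eqF (y0 k)) implybT. Qed.

Let yinv k : (y k)^-1 = y k `^ (-1).
Proof. by rewrite powR_inv1// ltW. Qed.

(** The exponents are chosen so that the noise and the bias, weighted by the
    potential, and the remainder of Young's inequality decay exactly like
    [(k + 4)^-1]; the curvature term [eta k ^ 2] decays at least as fast. *)
Lemma pot_noise k : pot k * gam k `^ alpha = (y k)^-1.
Proof.
rewrite gammaE -powRrM /pot ypD yinv; congr (_ `^ _).
by rewrite /pot_exp /gamma_exp DE; field; rewrite -DE.
Qed.

Lemma pot_bias k : pot k * (gam k `^ (1 - alpha) *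
  (eta k ^+ p / gam k ^+ p.-1) `^ alpha) = (y k)^-1.
Proof.
have pE : p.-1%:R = P - 1 by rewrite -subn1 natrB// ltnW.
rewrite gammaE etaE -!powR_mulrn ?powR_ge0// -!powRrM -[_^-1]powRN ypD -powRrM.
rewrite ypD /pot ypD yinv pE; congr (_ `^ _).
by rewrite /pot_exp /gamma_exp /eta_exp DE; field; rewrite -DE.
Qed.

Lemma eta_sqr_le k : eta k ^+ 2 <= (y k)^-1.
Proof.
rewrite etaE -powR_mulrn ?powR_ge0// -powRrM yinv ler_powR//.
  by have := y4 k; lra.
rewrite mulNr lerN2 /eta_exp mulrAC ler_pdivlMr// mul1r DE.
by have := P2; have := a1; lra.
Qed.

Lemma eta_pot k : (eta k `^ alpha / (gam k * pot k)) = (y k)^-1 `^ (alpha - 1).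
Proof.
rewrite yinv gammaE etaE /pot -!powRrM ypD -[_^-1]powRN ypD; congr (_ `^ _).
by rewrite /pot_exp /gamma_exp /eta_exp DE; field; rewrite -DE.
Qed.

(** The remainder of Young's inequality as [M_const] records it. *)
Definition young_const : R :=
  30 `^ (1 / (alpha - 1)) * (alpha - 1) * (2 / alpha) `^ (alpha / (alpha - 1)).

(** Young's inequality with the slope of the tangent tuned to [2 * eta k]. *)
Lemma young_momentum k x : 0 <= x ->
  2 * eta k * x <= 2 / 3 * gam k * pot k * x `^ alpha + young_const / y k.
Proof.
move=> x0; have /andP[g0 g1] := gamma_gt0_lt1 k; have w0 := pot_gt0 k.
have e0 := eta_gt0 k; have b0 : 0 < alpha - 1 by have := a1; lra.
have al0 : 0 < alpha by have := a1; lra.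
set A := 2 / 3 * gam k * pot k.
have A0 : 0 < A by rewrite !mulr_gt0//; lra.
(* [mu] solves [alpha * A * mu `^ (alpha - 1) = 2 * eta k] *)
pose z := 2 * eta k / (alpha * A).
have z0 : 0 < z by rewrite divr_gt0 ?mulr_gt0.
pose mu := z `^ (1 / (alpha - 1)).
have mu0 : 0 <= mu by exact: powR_ge0.
have t := powR_tangent (ltW a1) x0 mu0.
have m1 : mu `^ (alpha - 1) = z.
  by rewrite -powRrM div1r mulVf ?gt_eqF// powRr1// ltW.
rewrite m1 in t; have {}t := ler_wpM2l (ltW A0) t.
have e1 : A * (alpha * (z * x)) = 2 * eta k * x.
  by rewrite /z; field; rewrite !gt_eqF.
rewrite e1 in t; apply: (le_trans t); rewrite mulrDr lerD2l.
have e2 : mu `^ alpha = z `^ (alpha / (alpha - 1)).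
  by rewrite -powRrM; congr (_ `^ _); rewrite mulrAC mul1r.
have zE : z = 2 / alpha * (eta k / A).
  by rewrite /z; field; rewrite !gt_eqF.
have ypDA u v : A `^ u * A `^ v = A `^ (u + v).
  by rewrite powRD// (gt_eqF A0) implybT.
have e3 : A * (eta k / A) `^ (alpha / (alpha - 1)) =
    (eta k `^ alpha / A) `^ (1 / (alpha - 1)).
  have AE : A = (A `^ (alpha - 1)) `^ (1 / (alpha - 1)).
    by rewrite -powRrM div1r mulfV ?gt_eqF// powRr1// ltW.
  have -> : alpha / (alpha - 1) = alpha * (1 / (alpha - 1)) by rewrite div1r.
  rewrite powRrM {1}AE -powRM ?powR_ge0//; congr (_ `^ _).
  rewrite powRM ?invr_ge0 ?(ltW A0) ?(ltW e0)// mulrCA; congr (_ * _).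
  by rewrite -!(powR_inv1 (ltW A0)) -powRrM mulN1r ypDA; congr (_ `^ _); ring.
have e4 : eta k `^ alpha / A = 3 / 2 * (y k)^-1 `^ (alpha - 1).
  by rewrite -eta_pot /A; field; rewrite !gt_eqF.
have b1 : 0 < 1 / (alpha - 1) by rewrite divr_gt0.
rewrite e2 zE powRM ?divr_ge0 ?(ltW al0) ?(ltW A0) ?(ltW e0)//.
set X := (2 / alpha) `^ _; set Y := (eta k / A) `^ _.
have -> : A * ((alpha - 1) * (X * Y)) = (alpha - 1) * X * (A * Y) by ring.
rewrite e3 e4 powRM ?powR_ge0//.
rewrite -powRrM div1r mulfV ?gt_eqF// powRr1 ?invr_ge0 ?(ltW (y0 k))//.
rewrite mulrA ler_wpM2r ?invr_ge0 ?(ltW (y0 k))//.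
(* the remainder has the base [3 / 2], the constant has [30] *)
rewrite /young_const -/X div1r mulrC [X in X <= _]mulrA.
rewrite ler_wpM2r ?powR_ge0// ler_wpM2r ?(ltW b0)//.
by rewrite ge0_ler_powR ?invr_ge0 ?(ltW b0) ?nnegrE//; lra.
Qed.

End Rates.

(** * Summation of the potential and inversion of the rate *)

Section RateArithmetic.
Context {R : realType}.
Variables (p : nat) (alpha : R).
Hypothesis p2 : (2 <= p)%N.
Hypothesis alpha12 : 1 < alpha <= 2.

Local Notation P := (p%:R : R).
Local Notation D := (rate_denom p alpha).
Local Notation eta := (eta_seq p alpha).
Local Notation gam := (gamma_seq p alpha).

Let a1 : 1 < alpha. Proof. by case/andP: alpha12. Qed.
Let b0 : 0 < alpha - 1. Proof. by have := a1; lra. Qed.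
Let P2 : 2 <= P. Proof. by rewrite ler_nat. Qed.

(** Summation of [V k.+1 <= (1 - 2 / 3 * gam k) * V k + Q / (k + 4)] for the
    potential [V k = pot k * r k]. *)
Lemma potential_sum_le (Q : R) (A r : nat -> R) K : 0 <= r 0%N ->
  (forall k, r k.+1 = (1 - gam k) * r k + A k) ->
  (forall k, 0 <= A k) -> (forall k, 2 * pot p alpha k * A k <= Q / (k + 4)%:R)
    ->
  \sum_(k < K) (2 / 3 * gam k * pot p alpha k * r k) <=
    pot p alpha 0 * r 0%N + Q * \sum_(k < K) (k + 4)%:R^-1.
Proof.
move=> r00 rS A0 AQ.
have r_ge0 k : 0 <= r k.
  elim: k => // k IH; have /andP[g0 g1] := gamma_gt0_lt1 p2 alpha12 k.
  by rewrite rS addr_ge0// mulr_ge0// subr_ge0 ltW.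
suff h : \sum_(k < K) (2 / 3 * gam k * pot p alpha k * r k) +
    pot p alpha K * r K <= pot p alpha 0 * r 0%N + Q * \sum_(k < K) (k +
      4)%:R^-1.
  apply: le_trans h; rewrite lerDl mulr_ge0//.
  exact: ltW (pot_gt0 _ _ _).
elim: K => [|K IH]; first by rewrite !big_ord0 mulr0 add0r addr0.
have h1 := ler_wpM2r (r_ge0 K) (pot_contraction p2 alpha12 K).
have h2 := ler_wpM2r (A0 K) (pot_succ_le2 p2 alpha12 K).
have h3 := AQ K; rewrite !big_ord_recr/= rS mulrDr [Q * _]mulrDr.
move: (\sum_(k < K) _) IH h1 h2 h3 => S IH h1 h2 h3.
by lra.
Qed.

Lemma young_const_ge1 : 1 <= young_const alpha.
Proof.
have b0_ := b0; have u0 : 0 < 1 / (alpha - 1) by rewrite divr_gt0.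
have h1 : 1 / (alpha - 1) <= 30 `^ (1 / (alpha - 1)).
  have l30 : 1 <= ln 30 :> R by apply: ln_ge1; lra.
  rewrite /powR gt_eqF//; apply: le_trans (expR_ge1Dx _).
  by have := ler_wpM2l (ltW u0) l30; lra.
have h2 : 1 <= 30 `^ (1 / (alpha - 1)) * (alpha - 1).
  by have := ler_wpM2r (ltW b0) h1; rewrite mul1r mulVf ?gt_eqF.
have h3 : 1 <= (2 / alpha) `^ (alpha / (alpha - 1)).
  have al0 : 0 < alpha by have := a1; lra.
  rewrite -[X in X <= _](powRr0 (2 / alpha)) ler_powR//.
    by rewrite ler_pdivlMr// mul1r; case/andP: alpha12.
  by rewrite divr_ge0 ?(ltW b0) ?(ltW al0).
by rewrite /young_const; have := ler_pM ler01 ler01 h2 h3; rewrite mulr1.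
Qed.

Lemma rate_exp_bounds : 0 < P * (alpha - 1) / D <= 1.
Proof.
have /andP[e0 e1] := eta_exp_bounds p2 alpha12; rewrite eta_expE// in e0 e1.
rewrite divr_gt0 ?rate_denom_gt0 ?mulr_gt0//; [|by have := P2; lra].
by lra.
Qed.

(** The last of the [K] step sizes is the power of [K + 3 <= 2 * K] with an
    exponent in [[-1, 0]]. *)
Lemma inv_eta_sum_le K : (5 <= K)%N ->
  (K%:R * eta K.-1)^-1 <= 2 * K%:R `^ (- (P * (alpha - 1) / D)).
Proof.
move=> K5; have /andP[e0 e1] := eta_exp_bounds p2 alpha12.
have K0 : 0 < K%:R :> R by rewrite ltr0n; lia.
have le2K : (K.-1 + 4)%:R <= 2 * K%:R :> R by rewrite -natrM ler_nat; lia.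
have y0 : 0 < (K.-1 + 4)%:R :> R by rewrite ltr0n addn4.
rewrite etaE powRN invfM invrK.
have h : (K.-1 + 4)%:R `^ eta_exp p alpha <= 2 * K%:R `^ eta_exp p alpha.
  apply: (@le_trans _ _ ((2 * K%:R) `^ eta_exp p alpha)).
    by rewrite ge0_ler_powR ?nnegrE ?(ltW e0) ?(ltW y0)// mulr_ge0// ltW.
  rewrite powRM ?(ltW K0)// ler_wpM2r ?powR_ge0//.
  by rewrite ler1_powR//; lra.
apply: (le_trans (ler_wpM2l _ h)); first by rewrite invr_ge0 ltW.
rewrite mulrCA ler_wpM2l// -(powR_inv1 (ltW K0)) -powRD ?(gt_eqF K0) ?implybT//.
by rewrite eta_expE// addrA [-1 + 1]addNr add0r.
Qed.

(** With [y = K ^ rho], where [rho = P * (alpha - 1) / D], the claim reads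
    [c * ln y <= 4 * y] for [y >= c * ln c]. *)
Lemma final_rate_le (M eps : R) K : 4 <= M -> 0 < eps < 1 -> (5 <= K)%N ->
  let c := 2 * D * M / (P * (alpha - 1) * eps) in
  (c * ln c) `^ (D / (P * (alpha - 1))) <= K%:R ->
  2 * K%:R `^ (- (P * (alpha - 1) / D)) * (M / 4 * ln K%:R) <= eps.
Proof.
move=> M4 /andP[eps0 eps1] K5 c; have /andP[r0 r1] := rate_exp_bounds.
have K0 : 0 < K%:R :> R by rewrite ltr0n; lia.
have Pa0 : 0 < P * (alpha - 1) by rewrite mulr_gt0//; have := P2; lra.
have D0 := rate_denom_gt0 p2 alpha12.
set rho := P * (alpha - 1) / D in r0 r1 *.
have cE : c = 2 * M / (rho * eps).
  by rewrite /c /rho; field; rewrite !gt_eqF//; have := b0; have := P2; lra.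
have -> : D / (P * (alpha - 1)) = rho^-1 by rewrite /rho invf_div.
have re0 : 0 < rho * eps by rewrite mulr_gt0.
have re1 : rho * eps <= 1 by rewrite mulr_ile1 ?(ltW r0) ?(ltW eps0) ?(ltW
  eps1).
have c4 : 4 <= c.
  rewrite cE ler_pdivlMr//; apply: (@le_trans _ _ (4 * 1)); last by lra.
  by rewrite ler_wpM2l.
move=> Kc; set y := K%:R `^ rho.
have y0 : 0 < y by rewrite powR_gt0.
have lnc := ln_ge1 c4.
have cy : c * ln c <= y.
  have cl0 : 0 <= c * ln c by rewrite mulr_ge0//; lra.
  have -> : c * ln c = ((c * ln c) `^ rho^-1) `^ rho.
    by rewrite -powRrM mulVf ?gt_eqF// powRr1.
  by rewrite ge0_ler_powR ?nnegrE ?powR_ge0 ?(ltW r0) ?(ltW K0).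
have := mul_ln_le c4 cy.
have lny : ln y = rho * ln K%:R by rewrite /y ln_powR.
rewrite lny cE powRN -/y => h.
rewrite -(ler_pM2l y0).
have -> : y * (2 * y^-1 * (M / 4 * ln K%:R)) = M / 2 * ln K%:R.
  by field; rewrite gt_eqF.
have e : 2 * M / (rho * eps) * (rho * ln K%:R) = 2 * M * ln K%:R / eps.
  by field; rewrite !gt_eqF.
rewrite e ler_pdivrMr// in h; lra.
Qed.

End RateArithmetic.

(** * Constants and convergence *)

Section Constants.
Context {R : realType}.
Variables (p : nat) (alpha : R).
Hypothesis p2 : (2 <= p)%N.
Hypothesis alpha12 : 1 < alpha <= 2.
Variables (Lp sigma : R).
Hypothesis Lp0 : 0 < Lp.
Hypothesis sigma0 : 0 < sigma.

Local Notation P := (p%:R : R).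
Local Notation eta := (eta_seq p alpha).
Local Notation gam := (gamma_seq p alpha).

Lemma eta_nonincreasing j k : (j <= k)%N -> eta k <= eta j.
Proof.
move=> jk; have /andP[e0 _] := eta_exp_bounds p2 alpha12.
rewrite !etaE !powRN lef_pV2 ?posrE ?powR_gt0 ?ltr0n ?addn4//.
by rewrite ge0_ler_powR ?nnegrE ?ler_nat// ltW.
Qed.

(** What one iteration adds to the moment of the momentum error: bias and
    noise. *)
Definition recursion_input k : R :=
  gam k `^ (1 - alpha) * bias_bound p eta gam Lp k `^ alpha
  + 6 * (2 * gam k * p.-1%:R * sigma) `^ alpha.

Lemma recursion_input_ge0 k : 0 <= recursion_input k.
Proof. by rewrite addr_ge0 ?mulr_ge0 ?powR_ge0. Qed.

Definition bias_const : R :=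
  P `^ (2 * alpha * P) * Lp `^ alpha / (p`!)%:R `^ alpha.

Definition noise_const : R := (P - 1) `^ alpha * sigma `^ alpha.

Lemma pot_recursion_input k : 2 * pot p alpha k * recursion_input k <=
  (2 * bias_const + 48 * noise_const) / (k + 4)%:R.
Proof.
have /andP[g0 g1] := gamma_gt0_lt1 p2 alpha12 k.
have /andP[a1 a2] := alpha12.
have al0 : 0 <= alpha by lra.
have P1 : 0 <= P - 1 by rewrite subr_ge0 ler1n ltnW.
have f0 : 0 < p`!%:R :> R by rewrite ltr0n fact_gt0.
set v := eta k ^+ p / gam k ^+ p.-1.
have v0 : 0 <= v.
  exact: divr_ge0 (exprn_ge0 _ (ltW (eta_gt0 p alpha k))) (exprn_ge0 _ (ltW
    g0)).
have bE : bias_bound p eta gam Lp k `^ alpha = bias_const * v `^ alpha.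
  have -> : bias_bound p eta gam Lp k = P ^+ (2 * p) * Lp * (p`!%:R)^-1 * v.
    by rewrite /bias_bound /v mulrACA [RHS]mulrC; ring.
  have X0 : 0 <= P ^+ (2 * p) by rewrite exprn_ge0.
  have i0 : 0 <= p`!%:R^-1 :> R by rewrite invr_ge0 ltW.
  have XL0 := mulr_ge0 X0 (ltW Lp0).
  rewrite (powRM _ (mulr_ge0 XL0 i0) v0) (powRM _ XL0 i0) (powRM _ X0 (ltW
    Lp0)).
  rewrite -{1}(powR_mulrn (2 * p) (ler0n R p)) -powRrM.
  rewrite -(powR_inv1 (ltW f0)) -powRrM mulN1r powRN /bias_const.
  by congr (_ `^ _ * _ * _ * _); rewrite natrM mulrAC.
have nE : (2 * gam k * p.-1%:R * sigma) `^ alpha =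
    2 `^ alpha * (noise_const * gam k `^ alpha).
  rewrite -subn1 natrB ?(ltnW p2)// !powRM ?mulr_ge0 ?(ltW g0) ?(ltW sigma0)//.
  by rewrite /noise_const; ring.
have two : 2 `^ alpha <= 4 :> R.
  rewrite (_ : 4 = 2 `^ 2%:R); last by rewrite powR_mulrn//; ring.
  by apply: ler_powR => //; lra.
have pn := pot_noise p2 alpha12 k; have pb := pot_bias p2 alpha12 k.
rewrite -/v in pb; rewrite /recursion_input bE nE.
have N0 : 0 <= noise_const / (k + 4)%:R.
  by rewrite divr_ge0// mulr_ge0 ?powR_ge0.
have -> : 2 * pot p alpha k * (gam k `^ (1 - alpha) * (bias_const * v `^ alpha)
  +
    6 * (2 `^ alpha * (noise_const * gam k `^ alpha))) =
  2 * bias_const * (pot p alpha k * (gam k `^ (1 - alpha) * v `^ alpha)) +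
  12 * 2 `^ alpha * (noise_const * (pot p alpha k * gam k `^ alpha)) by ring.
rewrite pn pb [X in _ <= X]mulrDl lerD2l -[X in _ <= X]mulrA.
by rewrite ler_wpM2r//; lra.
Qed.

(** The additive structure of [M_const] mirrors the error sources: initial gap,
    initial error, curvature, Young remainder, bias and noise. *)
Lemma M_const_ge (gap L1 : R) : 0 <= gap -> 0 < L1 ->
  gap + pot p alpha 0 * sigma `^ alpha
    + (2 * bias_const + 48 * noise_const + young_const alpha + L1 / 2)
  <= M_const p alpha gap L1 sigma Lp / 4
  /\ 4 <= M_const p alpha gap L1 sigma Lp.
Proof.
move=> gap0 L10; have y1 := young_const_ge1 alpha12.
have b0 : 0 <= bias_const by rewrite divr_ge0 ?mulr_ge0 ?powR_ge0.
have n0 : 0 <= noise_const by rewrite mulr_ge0 ?powR_ge0.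
have s0 : 0 <= sigma `^ alpha by exact: powR_ge0.
have p0 := ler_wpM2r s0 (pot0_le p2 alpha12).
have f0 : 0 <= 4 `^ (1 / 3) * sigma `^ alpha by rewrite mulr_ge0 ?powR_ge0.
have -> : M_const p alpha gap L1 sigma Lp = 4 * (gap + 4 `^ (1 / 3) * sigma `^
  alpha
    + L1 / 2 + young_const alpha + 306 * bias_const + 64 * noise_const).
  by rewrite /M_const /bias_const /noise_const /young_const !mulrA.
by split; lra.
Qed.

End Constants.

(** The last step size is the smallest. *)
Lemma average_le_weighted {R : realType} (E : nat -> \bar R) (eta : nat -> R) K
  :
  (0 < K)%N -> (forall k, 0 <= E k)%E -> (forall k, 0 < eta k) ->
  (forall j k, (j <= k)%N -> eta k <= eta j) ->
  (\sum_(k < K) (K%:R^-1)%:E * E k <=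
   ((K%:R * eta K.-1)^-1)%:E * \sum_(k < K) (eta k)%:E * E k)%E.
Proof.
move=> K0 E0 eta0 mono.
have KR : 0 < K%:R :> R by rewrite ltr0n.
rewrite ge0_sume_distrr; last by move=> k _; rewrite mule_ge0// lee_fin ltW.
apply: lee_sum => k _; rewrite muleA -EFinM lee_wpmul2r// lee_fin.
rewrite invfM -mulrA ler_peMr ?invr_ge0 ?(ltW KR)//.
by rewrite ler_pdivlMl// mulr1 mono//; have := ltn_ord k; lia.
Qed.

Theorem theorem3 (R : realType) (n : nat)
    (d : measure_display) (Om : measurableType d) (P : probability Om R)
    (d' : measure_display) (Xi : measurableType d')
    (f : 'rV[R]_n -> R)
    (xi : {RV P >-> Xi}) (G : 'rV[R]_n -> Xi -> 'rV[R]_n)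
    (f_low L1 sigma alpha : R) (p : nat) (Lp : R)
    (f_C1 : Ck 1 f)
    (f_has_min : exists xopt, forall y, f xopt <= f y)
    (G_meas : jointly_measurable G)
    (* Basic Assumptions (a)-(c) *)
    (f_lower_bound : forall y, f_low <= f y)
    (L1_gt0 : 0 < L1)
    (grad_lipschitz : forall y z,
      enorm (grad f y - grad f z) <= L1 * enorm (y - z))
    (sigma_gt0 : 0 < sigma)
    (alpha_range : 1 < alpha <= 2)
    (G_unbiased : forall y (i : 'I_n),
      ('E_P[fun w => G y (xi w) ord0 i] = (grad f y ord0 i)%:E)%E)
    (G_moment : forall y,
      ('E_P[fun w => (enorm (G y (xi w) - grad f y) `^ alpha)%R]
        <= (sigma `^ alpha)%R%:E)%E)
    (* High-order smoothness *)
    (p_ge2 : (2 <= p)%N)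
    (f_Cp : Ck p f)
    (Lp_gt0 : 0 < Lp)
    (Dp_lipschitz : forall y z,
      (form_norm (fun h : p.-tuple 'rV[R]_n =>
          (Dform f h y - Dform f h z)%R)
        <= (Lp * enorm (y - z))%R%:E)%E)
    (* The algorithm, with q = p - 1, run on i.i.d. copies of xi *)
    (x0 : 'rV[R]_n)
    (xis : nat -> {RV P >-> Xi})
    (xis_law : forall k, same_distribution (xis k) xi)
    (xis_indep : mutually_independent xis)
    (x m : nat -> Om -> 'rV[R]_n)
    (xm_generated : forall w,
      multi_extrapolated_path G x0 p.-1 (eta_seq p alpha)
        (gamma_par p alpha) (theta_par p alpha)
        (fun k => xis k w) (fun k => x k w) (fun k => m k w))
    (m_neq0 : {ae P, forall w, forall k, m k w != 0}) :
  let M := M_const p alpha (f x0 - f_low) L1 sigma Lp in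
  forall eps : R, 0 < eps < 1 ->
  let c := 2 * (p%:R * (2 * alpha - 1) + alpha - 1) * M
             / (p%:R * (alpha - 1) * eps) in
  forall K : nat,
    Num.max ((c * ln c) `^ ((p%:R * (2 * alpha - 1) + alpha - 1)
                              / (p%:R * (alpha - 1)))) 5 <= K%:R ->
  forall iota : {RV P >-> nat},
    uniform_index K iota ->
    independent_of_samples iota xis ->
    ('E_P[fun w => enorm (grad f (x (iota w) w))] <= eps%:E)%E.
Proof.
move=> M eps eps01 c K Kmax iota iota_unif iota_indep.
have [K5 Kc] : (5 <= K)%N /\ (c * ln c) `^ ((p%:R * (2 * alpha - 1) + alpha - 1)
    / (p%:R * (alpha - 1))) <= K%:R.
  by move: Kmax; rewrite ge_max => /andP[h1 h2]; split=> //;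
    rewrite -(ler_nat R).
have K0 : (0 < K)%N by exact: leq_trans K5.
pose eta := eta_seq p alpha; pose gam := gamma_seq p alpha.
have eta0 k : 0 < eta k := eta_gt0 p alpha k.
have gam01 k : 0 < gam k < 1 := gamma_gt0_lt1 p_ge2 alpha_range k.
have a12 := alpha_range;
  have [a1 a2] : 1 < alpha /\ alpha <= 2 by case/andP: a12.
pose e k w := enorm (m k w - grad f (x k w)) `^ alpha.
pose gn k w := enorm (grad f (x k w)).
pose A := recursion_input p alpha Lp sigma.
(* the recursion of the error moments, run with equality *)
pose r k := iteri k (fun j s => (1 - gam j) * s + A j) (sigma `^ alpha).
have err k : (\int[P]_w (e k w)%:E <= (r k)%:E)%E.
  apply: (error_moment_le f_C1 G_meas p_ge2 xm_generated eta0 gam01 f_Cp Lp_gt0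
    Dp_lipschitz a12 sigma_gt0 xis_law xis_indep G_unbiased G_moment) => //.
pose Q := 2 * bias_const p alpha Lp + 48 * noise_const p alpha sigma.
pose a k := 2 / 3 * gam k * pot p alpha k.
have a0 k : 0 <= a k.
  have /andP[g0 _] := gam01 k; have := pot_gt0 p alpha k.
  by move=> ?; rewrite !mulr_ge0 ?ltW.
pose q := young_const alpha + L1 / 2.
pose H : R := \sum_(k < K) (k + 4)%:R^-1.
(* the potential pays for the momentum errors and the values of [f] telescope *)
have pathwise w : \sum_(k < K) eta k * gn k w <=
    (f x0 - f_low + q * H) + \sum_(k < K) a k * e k w.
  have step k : eta k * gn k w <= (f (x k w) - f (x k.+1 w)) +
      (a k * e k w + q / (k + 4)%:R).
    have h1 := one_step_descent f_C1 xm_generated eta0 k w L1_gt0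
      grad_lipschitz.
    have h2 := young_momentum p_ge2 a12 k (enorm_ge0 (m k w - grad f (x k w))).
    have h3 := ler_wpM2l (ltW L1_gt0) (eta_sqr_le p_ge2 a12 k).
    rewrite -/eta in h1 h2 h3; rewrite -/gam in h2.
    apply: (le_trans h1); rewrite /q /a /e.
    by move: h2 h3; move: (k + 4)%:R^-1 (enorm _ `^ alpha) => y z h2 h3; lra.
  have tele N : \sum_(k < N) (f (x k w) - f (x k.+1 w)) = f x0 - f (x N w).
    elim: N => [|N IH]; first by rewrite big_ord0 (path_init (xm_generated w))
      subrr.
    by rewrite big_ord_recr/= IH addrA subrK.
  apply: (le_trans (ler_sum _ (fun (k : 'I_K) _ => step k))).
  rewrite big_split/= tele big_split/= -mulr_sumr -/H.
  by have := f_lower_bound (x K w); lra.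
have mid (d2 : measure_display) (T : measurableType d2) (phi : T -> Om) :
    (forall j, measurable_fun setT (xis j \o phi)) -> forall k,
    measurable_fun setT (fun t => gn k (phi t)) /\
    measurable_fun setT (fun t => e k (phi t)).
  move=> mxis k; split.
    apply: measurable_enorm; apply: vmeasurable_grad => //.
    by have [] := path_measurable G_meas xm_generated (k := k) (fun j _ =>
      mxis j).
  apply: measurable_powR_enorm.
  by apply: (vmeasurable_momentum_error f_C1 G_meas xm_generated) => j _.
have mO k := mid _ _ (id : Om -> Om) (fun j => measurable_funPT (xis j)) k.
have gn0 k w : 0 <= gn k w by exact: enorm_ge0.
have e0 k w : 0 <= e k w by exact: powR_ge0.
have C0 : 0 <= f x0 - f_low + q * H.
  rewrite addr_ge0 ?subr_ge0// mulr_ge0//.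
    rewrite addr_ge0 ?divr_ge0 ?(ltW L1_gt0)//.
    exact: le_trans ler01 (young_const_ge1 a12).
  by rewrite sumr_ge0// => k _; rewrite invr_ge0.
have sum_le : (\sum_(k < K) (eta k)%:E * \int[P]_w (gn k w)%:E <=
    (f x0 - f_low + q * H + \sum_(k < K) a k * r k)%:E)%E.
  have -> : (\sum_(k < K) (eta k)%:E * \int[P]_w (gn k w)%:E)%E =
      (\int[P]_w (\sum_(k < K) eta k * gn k w)%:E)%E.
    under [RHS]eq_integral do rewrite -sumEFin.
    rewrite ge0_integral_sum//; last 2 first.
    - move=> k; apply/measurable_EFinP; apply: measurable_funM => //.
      by have [] := mO k.
    - by move=> k w _; rewrite lee_fin mulr_ge0// ltW.
    apply: eq_bigr => k _; under [RHS]eq_integral do rewrite EFinM.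
    rewrite ge0_integralZl//.
    - by apply/measurable_EFinP; have [] := mO k.
    - by move=> w _; rewrite lee_fin.
    - by rewrite lee_fin ltW.
  apply: (@le_trans _ _ (\int[P]_w ((f x0 - f_low + q * H)%:E +
      \sum_(k < K) (a k)%:E * (e k w)%:E))%E).
    apply: ge0_le_integral => //.
    - by move=> w _; rewrite lee_fin sumr_ge0// => k _; rewrite mulr_ge0// ltW.
    - apply/measurable_EFinP; apply: measurable_sum => k.
      by apply: measurable_funM => //; have [] := mO k.
    - apply: emeasurable_funD => //; apply: emeasurable_sum => k.
      by apply: measurable_funeM; apply/measurable_EFinP; have [] := mO k.
    - move=> w _; have -> : (\sum_(k < K) (a k)%:E * (e k w)%:E)%E =
          (\sum_(k < K) a k * e k w)%:E by rewrite -sumEFin.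
      by rewrite -EFinD lee_fin; exact: pathwise.
  rewrite ge0_integralD//; last 2 first.
  - by move=> w _; apply: sume_ge0 => k _; rewrite mule_ge0 ?lee_fin.
  - apply: emeasurable_sum => k.
    by apply: measurable_funeM; apply/measurable_EFinP; have [] := mO k.
  rewrite integral_cst//= probability_setT mule1 [X in (_ <= X)%E]EFinD
    leeD2l//.
  rewrite ge0_integral_sum//; last 2 first.
  - by move=> k; apply: measurable_funeM; apply/measurable_EFinP;
    have [] := mO k.
  - by move=> k w _; rewrite mule_ge0 ?lee_fin.
  rewrite -sumEFin; apply: lee_sum => k _; rewrite ge0_integralZl//.
  - by rewrite [X in (_ <= X)%E]EFinM lee_wpmul2l// lee_fin.
  - by apply/measurable_EFinP; have [] := mO k.
  - by move=> w _; rewrite lee_fin.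
  - by rewrite lee_fin.
have K2 : (2 <= K)%N by exact: leq_trans K5.
have HlnK : H <= ln K%:R := harmonic_le_ln K2.
have lnK1 : 1 <= ln K%:R :> R.
  by apply: ln_ge1; rewrite ler_nat; exact: leq_trans K5.
have gap0 : 0 <= f x0 - f_low by rewrite subr_ge0.
have [MC M4] := M_const_ge p_ge2 a12 Lp sigma gap0 L1_gt0.
rewrite -/M in MC M4.
have Q0 : 0 <= Q.
  by rewrite addr_ge0// mulr_ge0// ?divr_ge0 ?mulr_ge0 ?powR_ge0.
have total : f x0 - f_low + q * H + \sum_(k < K) a k * r k <= M / 4 * ln K%:R.
  have := potential_sum_le p_ge2 a12 (Q := Q) (A := A) (r := r) K (powR_ge0 _ _)
    (fun k => erefl) (recursion_input_ge0 _ _ _ _)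
    (pot_recursion_input p_ge2 a12 Lp_gt0 sigma_gt0).
  rewrite -[\sum_(k < K) (_ * r k)]/(\sum_(k < K) a k * r k) -/H => h.
  apply: (@le_trans _ _ ((f x0 - f_low + pot p alpha 0 * sigma `^ alpha + (Q +
    q)) * ln K%:R)).
    have q0 : 0 <= q.
      rewrite addr_ge0 ?divr_ge0 ?(ltW L1_gt0)//.
      exact: le_trans ler01 (young_const_ge1 a12).
    have hQ := ler_wpM2l (addr_ge0 Q0 q0) HlnK.
    have s0 : 0 <= pot p alpha 0 * sigma `^ alpha.
      by rewrite mulr_ge0 ?powR_ge0.
    have hg := ler_wpM2l (addr_ge0 gap0 s0) lnK1.
    by move: h hQ hg; rewrite -[r 0%N]/(sigma `^ alpha); lra.
  rewrite ler_wpM2r//; first by lra.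
  by apply: le_trans MC; rewrite /Q /q; lra.
rewrite unlock.
rewrite (@integral_uniform_index _ _ _ _ _ _ xis iota K K0 iota_unif iota_indep
  gn gn0); last first.
  move=> k; have [|//] := mid _ (g_sigma_algebraType (all_events xis)) id _ k.
  move=> j _ B mB; rewrite setTI; apply: sub_sigma_algebra.
  by exists j, B.
have E0 k : (0 <= \int[P]_w (gn k w)%:E)%E.
  by apply: integral_ge0 => w _; rewrite lee_fin.
have := average_le_weighted K0 E0 eta0 (eta_nonincreasing p_ge2 a12).
move=> /le_trans; apply.
have inv0 : 0 <= (K%:R * eta K.-1)^-1 by rewrite invr_ge0 mulr_ge0// ltW.
apply: (le_trans (lee_wpmul2l _ sum_le)); first by rewrite lee_fin.
rewrite -EFinM lee_fin.
apply: le_trans (final_rate_le p_ge2 a12 M4 eps01 K5 Kc).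
have r_ge0 k : 0 <= r k.
  rewrite -lee_fin; apply: le_trans (err k).
  by apply: integral_ge0 => w _; rewrite lee_fin.
apply: ler_pM => //.
  by rewrite addr_ge0// sumr_ge0// => k _; rewrite mulr_ge0.
exact: inv_eta_sum_le.
Qed.
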